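(* Let $S_1,S_2,\ldots$ be i.i.d. copies of a discrete generalized Pareto random variable $S$ with tail index $\beta>0$ and slowly varying function $L$. Let $(k_n)$ be a sequence of real numbers such that, as $n\to+\infty$, $k_n\to+\infty$, $(\ln n)\exp(k_n\beta)/n=o(L(\exp(k_n)))$, and $$\sqrt{np_{k_n}}\left(1-\frac{L(e^{k_n})}{L(e^{k_n+1})}\right)\to 0.$$ Then: (i) $\sqrt{np_{k_n}}\left(\widehat\beta_n(k_n)-\beta\right)\Rightarrow\mathcal{N}(0,\,e^\beta-1)$ in distribution as $n\to+\infty$; (ii) as $n\to+\infty$, $$\frac{\sqrt{n\widehat p^{(n)}_{k_n}}\left(\widehat\beta_n(k_n)-\beta\right)}{\sqrt{e^{\widehat\beta_n(k_n)}-1}}\Rightarrow\mathcal{N}(0,1)\quad\text{in distribution}.$$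
   Context: $S$ is a random variable with values in $\{1,2,3,\ldots\}$ such that $\mathbb{P}(S>x)=x^{-\beta}L(x)$ for all real $x\geq 1$, where $\beta>0$ and $L:\mathbb{R}_+\to\mathbb{R}$ is slowly varying, i.e. $L(\lambda z)/L(z)\to 1$ as $z\to+\infty$ for every $\lambda>0$. For real $l$, $p_l=\mathbb{P}(S>e^{l})$ and $\widehat p^{(n)}_l=\frac1n\sum_{i=1}^n\mathbb{I}\{S_i>e^l\}$. The estimator is $\widehat\beta_n(k)=\ln(\widehat p^{(n)}_k)-\ln(\widehat p^{(n)}_{k+1})$ if $\widehat p^{(n)}_{k+1}>0$, and $\widehat\beta_n(k)=0$ if $\widehat p^{(n)}_{k+1}=0$. $\mathcal{N}(0,\sigma^2)$ is the centered normal law with variance $\sigma^2$. On the event where the denominator in (ii) vanishes, the ratio is given an arbitrary value (e.g. $0$). *)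

(* Defs.v *)
From HB Require Import structures.
From mathcomp Require Import all_boot all_order all_algebra finmap.
From mathcomp Require Import all_classical all_reals all_analysis.
From mathcomp Require Import measurable_realfun.

Set Implicit Arguments.
Unset Strict Implicit.
Unset Printing Implicit Defensive.

Import Order.TTheory GRing.Theory Num.Theory.
Import numFieldNormedType.Exports.

Local Open Scope classical_set_scope.
Local Open Scope ring_scope.

(* Only the values of L near +oo matter: a function on R_+ is represented by
   any total extension.  Since x / 0 = 0, the limit 1 forces L z != 0 for all
   large z. *)
Definition slowly_varying (R : realType) (L : R -> R) : Prop :=
  forall lambda : R, 0 < lambda ->
    L (lambda * z) / L z @[z --> +oo%R] --> (1 : R).

Definition discrete_gen_pareto d (T : measurableType d) (R : realType)
    (P : probability T R) (S : {RV P >-> nat}) (beta : R) (L : R -> R) : Prop :=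
  [/\ 0 < beta,
      slowly_varying L,
      forall w, (0 < S w)%N &
      forall x : R, 1 <= x ->
        P [set w | x < (S w)%:R] = (x `^ (- beta) * L x)%:E].

Definition mutually_independent d (T : measurableType d) (R : realType)
    (P : probability T R) d' (T' : measurableType d') (I : choiceType)
    (X : I -> {RV P >-> T'}) : Prop :=
  forall (J : {fset I}) (A : I -> set T'), (forall i, measurable (A i)) ->
    P (\bigcap_(i in [set` J]) (X i @^-1` A i)) =
    (\prod_(i <- J) P (X i @^-1` A i))%E.

Definition same_law d (T : measurableType d) (R : realType)
    (P : probability T R) d' (T' : measurableType d')
    (X Y : {RV P >-> T'}) : Prop :=
  forall A : set T', measurable A -> distribution P X A = distribution P Y A.

Definition iid_copies d (T : measurableType d) (R : realType)
    (P : probability T R) d' (T' : measurableType d')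
    (X : nat -> {RV P >-> T'}) (Y : {RV P >-> T'}) : Prop :=
  mutually_independent X /\ forall i, same_law (X i) Y.

Definition cvg_in_distribution d (T : measurableType d) (R : realType)
    (P : probability T R) (X : nat -> {RV P >-> R})
    (mu : probability (measurableTypeR R) R) : Prop :=
  forall x : R, {for x, continuous (fun y : R => mu `]-oo, y]%classic)} ->
    cdf (X n) x @[n --> \oo] --> mu `]-oo, x]%classic.

Definition tail_prob d (T : measurableType d) (R : realType)
    (P : probability T R) (S : {RV P >-> nat}) (l : R) : R :=
  fine (P [set w | expR l < (S w)%:R]).

(* The sample S_1, S_2, ... is indexed from 0. *)
Definition emp_tail_prob d (T : measurableType d) (R : realType)
    (P : probability T R) (S_ : nat -> {RV P >-> nat}) (n : nat) (l : R)
    (w : T) : R :=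
  n%:R^-1 * \sum_(i < n) \1_[set v | expR l < (S_ i v)%:R] w.

Definition tail_index_est d (T : measurableType d) (R : realType)
    (P : probability T R) (S_ : nat -> {RV P >-> nat}) (n : nat) (k : R)
    (w : T) : R :=
  if 0 < emp_tail_prob S_ n (k + 1) w
  then ln (emp_tail_prob S_ n k w) - ln (emp_tail_prob S_ n (k + 1) w)
  else 0.

Definition normalized_error d (T : measurableType d) (R : realType)
    (P : probability T R) (S : {RV P >-> nat}) (S_ : nat -> {RV P >-> nat})
    (beta : R) (n : nat) (k : R) (w : T) : R :=
  Num.sqrt (n%:R * tail_prob S k) * (tail_index_est S_ n k w - beta).

(* [a] is the value given to the ratio when its denominator vanishes. *)
Definition studentized_error d (T : measurableType d) (R : realType)
    (P : probability T R) (S_ : nat -> {RV P >-> nat})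
    (beta a : R) (n : nat) (k : R) (w : T) : R :=
  let den := Num.sqrt (expR (tail_index_est S_ n k w) - 1) in
  if den == 0 then a
  else Num.sqrt (n%:R * emp_tail_prob S_ n k w)
         * (tail_index_est S_ n k w - beta) / den.

Section measurability.
Context d (T : measurableType d) (R : realType) (P : probability T R).
Variables (S : {RV P >-> nat}) (S_ : nat -> {RV P >-> nat}).

Lemma measurable_emp_tail_prob n (l : R) :
  measurable_fun [set: T] (emp_tail_prob S_ n l).
Proof.
apply: measurable_funM => //; apply: measurable_sum => i.
apply: measurable_indic.
have -> : [set v | expR l < (S_ i v)%:R] = S_ i @^-1` [set m | expR l < m%:R :> R].
  by [].
by rewrite -[X in measurable X]setTI; exact: measurable_funP.
Qed.

HB.instance Definition _ n (l : R) :=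
  isMeasurableFun.Build _ _ _ _ (emp_tail_prob S_ n l)
    (measurable_emp_tail_prob n l).

Lemma measurable_tail_index_est n (k : R) :
  measurable_fun [set: T] (tail_index_est S_ n k).
Proof.
apply: measurable_fun_ifT => //=.
- by apply: measurable_fun_ltr => //; exact: measurable_emp_tail_prob.
- by apply: measurable_funB; (apply: measurableT_comp;
    [exact: measurable_ln|exact: measurable_emp_tail_prob]).
Qed.

HB.instance Definition _ n (k : R) :=
  isMeasurableFun.Build _ _ _ _ (tail_index_est S_ n k)
    (measurable_tail_index_est n k).

Lemma measurable_normalized_error (beta : R) n (k : R) :
  measurable_fun [set: T] (normalized_error S S_ beta n k).
Proof.
by apply: measurable_funM => //; apply: measurable_funB.
Qed.

HB.instance Definition _ (beta : R) n (k : R) :=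
  isMeasurableFun.Build _ _ _ _ (normalized_error S S_ beta n k)
    (measurable_normalized_error beta n k).

Lemma measurable_studentized_error (beta a : R) n (k : R) :
  measurable_fun [set: T] (studentized_error S_ beta a n k).
Proof.
have msqrt : measurable_fun [set: R] (@Num.sqrt R).
  by apply: continuous_measurable_fun; exact: sqrt_continuous.
pose den w := Num.sqrt (expR (tail_index_est S_ n k w) - 1).
have mden : measurable_fun [set: T] den.
  apply: measurableT_comp => //; apply: measurable_funB => //.
  exact: measurableT_comp.
rewrite (_ : studentized_error _ _ _ _ _ = fun w => if den w == 0 then a else
    Num.sqrt (n%:R * emp_tail_prob S_ n k w) * (tail_index_est S_ n k w - beta)
      * expR (- ln (den w))); last first.
  apply/funext => w; rewrite /studentized_error -/(den w).
  have [//|d0] := eqVneq (den w) 0.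
  by rewrite expRN lnK // posrE lt_neqAle eq_sym d0 sqrtr_ge0.
apply: measurable_fun_ifT => //=.
- by apply: measurable_fun_eqr.
- apply: measurable_funM; first apply: measurable_funM.
  + by apply: measurableT_comp => //; exact: measurable_funM.
  + exact: measurable_funB.
  + apply: measurableT_comp => //; apply: measurableT_comp => //.
    by apply: measurableT_comp => //; exact: measurable_ln.
Qed.

HB.instance Definition _ (beta a : R) n (k : R) :=
  isMeasurableFun.Build _ _ _ _ (studentized_error S_ beta a n k)
    (measurable_studentized_error beta a n k).

End measurability.

(* Main.v *)
Require Import Defs.
From HB Require Import structures.
From mathcomp Require Import all_boot all_order all_algebra finmap.
From mathcomp Require Import all_classical all_reals all_analysis.
From mathcomp Require Import measurable_realfun ring lra.

Set Implicit Arguments.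
Unset Strict Implicit.
Unset Printing Implicit Defensive.

Import Order.TTheory GRing.Theory Num.Theory.
Import numFieldNormedType.Exports.

Local Open Scope classical_set_scope.
Local Open Scope ring_scope.

(** Let N_n = n p_(k_n) be the mean number of observations above e^(k_n), and let
    A and B be the numbers of observations above e^(k_n) and e^(k_n + 1).  The
    estimator is ln (A / B), so as soon as B > 0 the event that
    sqrt(N_n) (ln (A / B) - beta) is at most x is the event A - c_n B <= 0 with
    c_n = exp (beta + x / sqrt(N_n)).  Now A - c_n B is a sum of n i.i.d. variables
    with three values, and the central limit theorem for triangular arrays gives
    the limit of the probability of that event.  Writing
    r_n = e^beta p_(k_n + 1) / p_(k_n), which tends to 1, the normalised mean
    sqrt(N_n) (1 - r_n exp (x / sqrt(N_n))) tends to - x because the bias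
    sqrt(N_n) (1 - r_n) vanishes, and the normalised variance tends to
    1 - 2 + e^beta.  This is [count_clt], and part (i) is [normalized_error_clt].

    The central limit theorem [walk_clt] is proved by Lindeberg replacement
    against an explicit solution of the heat equation.  With Phi the standard
    normal distribution function, u(v, y) = Phi (y / sqrt v) satisfies
    u_v = u_yy / 2, so averaging u(v, .) over one centred step of variance s
    agrees with u(v + s, .) up to an error of order b s + s^2, where b bounds the
    step ([walk_step_gauss]).  Iterating n times moves the variance from a small
    d^4 to d^4 + n s; the function u(d^4, .) is a smoothed indicator of a half
    line, and letting d tend to 0 removes the smoothing.  Expectations of
    functions of the sum are iterates of the operator [walk_step], and
    [iid_walk_prob] links them to the probability space through mutual
    independence.

    For part (ii), A / N_n and B / N_n converge in probability to 1 and e^(-beta)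
    by Chebyshev's inequality ([emp_tail_prob_deviation]), hence the studentized
    error is the normalised error divided by sigma = sqrt(e^beta - 1) times a
    factor that converges to 1 in probability, and Slutsky's argument
    ([slutsky_ratio]) applies.

    Finally, the rate assumed on k_n says that ln n is negligible with respect to
    N_n, so N_n tends to infinity ([expected_exceedances_pinfty]), and slow
    variation turns the bias assumption on L into the one on r_n
    ([tail_prob_ratio_bias]). *)

(** * The standard normal distribution function *)

Section gaussian_cdf.
Context {R : realType}.
Implicit Types (x y s : R).

Definition gauss_cdf x : R := fine (normal_prob 0 1 `]-oo, x]%classic).

Let normal_cdf_derive s x : s != 0 ->
  is_derive x 1 (fun y => fine (normal_prob 0 s `]-oo, y]%classic))
    (normal_pdf 0 s x).
Proof.
move=> s0.
have ip : (@lebesgue_measure R).-integrable `]-oo, x + 1] (EFin \o normal_pdf 0 s).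
  by apply: integrableS (integrable_normal_pdf 0 s).
have cp : {for x, continuous (normal_pdf 0 s)} by exact: continuous_normal_pdf.
have xu : x < x + 1 by rewrite ltrDl.
have [dF FE] := continuous_FTC1 xu ip (ltNyr _) cp.
rewrite derive1E in FE; exact: DeriveDef dF FE.
Qed.

Let idR : measurableTypeR R -> R := idfun.

#[local] HB.instance Definition _ :=
  @isMeasurableFun.Build _ _ _ _ idR (@measurable_id _ _ setT).

Let normal_cdfE s x :
  normal_prob 0 s `]-oo, x]%classic = cdf (idR : {RV (normal_prob 0 s) >-> R}) x.
Proof. by []. Qed.

Let normal_cdf_cvgNy s :
  fine (normal_prob 0 s `]-oo, y]%classic) @[y --> -oo] --> (0 : R).
Proof. exact/fine_cvg/(cvg_cdfNy0 (idR : {RV (normal_prob 0 s) >-> R})). Qed.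

Lemma gauss_cdf_cvgy : gauss_cdf y @[y --> +oo] --> (1 : R).
Proof. exact/fine_cvg/(cvg_cdfy1 (idR : {RV (normal_prob 0 1) >-> R})). Qed.

Lemma gauss_cdf_cvgNy : gauss_cdf y @[y --> -oo] --> (0 : R).
Proof. exact: normal_cdf_cvgNy. Qed.

Lemma gauss_cdf_ge0 x : 0 <= gauss_cdf x.
Proof. by rewrite fine_ge0. Qed.

Lemma gauss_cdf_le1 x : gauss_cdf x <= 1.
Proof.
by rewrite -lee_fin fineK ?fin_num_measure//; exact: probability_le1.
Qed.

Lemma le_gauss_cdf : {homo gauss_cdf : x y / x <= y}.
Proof.
move=> x y xy; rewrite fine_le ?fin_num_measure//.
by rewrite le_measure ?inE//; exact: subitvPr.
Qed.

Lemma is_derive_gauss_cdf x : is_derive x 1 gauss_cdf (normal_pdf 0 1 x).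
Proof. by apply: normal_cdf_derive; rewrite oner_eq0. Qed.

Lemma continuous_gauss_cdf : continuous gauss_cdf.
Proof.
move=> x; apply: differentiable_continuous.
exact/derivable1_diffP/(@ex_derive _ _ _ _ _ _ _ (is_derive_gauss_cdf x)).
Qed.

Let normal_pdf_scale s x : 0 < s ->
  normal_pdf 0 s x = s^-1 * normal_pdf 0 1 (s^-1 * x).
Proof.
move=> s0; rewrite !normal_pdfE ?gt_eqF//= mulrA; congr (_ * _).
  rewrite /normal_peak expr1n mul1r -mulrnAr sqrtrM ?sqr_ge0//.
  by rewrite sqrtr_sqr gtr0_norm// invfM.
rewrite /normal_fun; congr expR; rewrite !subr0; field.
by rewrite gt_eqF.
Qed.

(** Both sides have the same derivative and the same limit 0 at minus infinity. *)
Lemma normal_probE s x : 0 < s ->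
  normal_prob 0 s `]-oo, x]%classic = (gauss_cdf (x / s))%:E.
Proof.
move=> s0; rewrite -[LHS]fineK; last first.
  by rewrite normal_cdfE; exact: fin_num_measure.
congr EFin.
pose f y := fine (normal_prob 0 s `]-oo, y]%classic) - gauss_cdf (s^-1 * y).
have df y : is_derive y 1 f 0.
  have dl : is_derive y 1 (fun z => s^-1 * z) s^-1.
    by apply: is_derive_eq; rewrite /GRing.scale/=; ring.
  have dg : is_derive y 1 (gauss_cdf \o (fun z => s^-1 * z))
      (normal_pdf 0 1 (s^-1 * y) * s^-1).
    by apply: is_derive1_comp; exact: is_derive_gauss_cdf.
  have df : is_derive y 1 (fun y => fine (normal_prob 0 s `]-oo, y]%classic))
      (normal_pdf 0 s y) by apply: normal_cdf_derive; rewrite gt_eqF.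
  apply: (is_derive_eq (is_deriveB df dg)).
  by rewrite normal_pdf_scale// mulrC subrr.
have f0 : f y @[y --> -oo] --> (0 : R).
  rewrite -[X in _ --> X](subrr 0); apply: cvgB; first exact: normal_cdf_cvgNy.
  apply: (@cvg_comp _ _ _ (fun z => s^-1 * z) gauss_cdf _ -oo).
    by apply: gt0_cvgMrNy; [rewrite invr_gt0|exact: cvg_id].
  exact: gauss_cdf_cvgNy.
have : f x = 0.
  apply/esym; apply: (cvg_unique _ f0) => //.
  by rewrite (_ : f = cst (f x)); [exact: cvg_cst|
    apply/funext => y; exact: is_derive_0_is_cst].
by move/eqP; rewrite subr_eq0 mulrC => /eqP.
Qed.

End gaussian_cdf.

(** * Taylor bounds *)

Section taylor.
Context {R : realType}.
Implicit Types (f : R -> R) (a b r M : R).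

(** The bound on the derivative is required on a ball, not on the segment between
    the two points, so that both orders of the points are treated alike. *)
Lemma mvt_bound f (f1 : R -> R) a r M : (forall x : R, is_derive x (1 : R) f (f1 x)) ->
  (forall x, `|x - a| <= r -> `|f1 x| <= M) ->
  forall b, `|b - a| <= r -> `|f b - f a| <= M * `|b - a|.
Proof.
move=> df bf b ba.
have cf u v : {within `[u, v], continuous f}.
  apply/continuous_subspaceT => z.
  exact/differentiable_continuous/derivable1_diffP.
have [ab|ab] := leP a b.
  have [c] := MVT_segment ab (fun x _ => df x) (cf _ _).
  rewrite in_itv/= => /andP[ac cb] ->; rewrite normrM ler_wpM2r//.
  apply: bf; apply: le_trans ba; rewrite !ger0_norm ?subr_ge0//.
  by rewrite lerD2r.
have [c] := MVT_segment (ltW ab) (fun x _ => df x) (cf _ _).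
rewrite in_itv/= => /andP[ac cb]; rewrite distrC => ->.
rewrite [in leRHS]distrC normrM ler_wpM2r//.
apply: bf; apply: le_trans ba; rewrite !ler0_norm ?subr_le0 ?(ltW ab)//.
by rewrite lerN2 lerD2r.
Qed.

(** Subtracting the affine part leaves a function whose derivative is controlled
    by [mvt_bound]; Taylor's factor 1/2 is lost on the way. *)
Lemma taylor2_bound f (f1 f2 : R -> R) a r M : (forall x : R, is_derive x (1 : R) f (f1 x)) ->
  (forall x : R, is_derive x (1 : R) f1 (f2 x)) ->
  (forall x, `|x - a| <= r -> `|f2 x| <= M) ->
  forall b, `|b - a| <= r -> `|f b - f a - f1 a * (b - a)| <= M * `|b - a| ^+ 2.
Proof.
move=> df df1 bf b ba.
pose g x := f x - f1 a * x.
have dg x : is_derive x (1 : R) g (f1 x - f1 a).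
  rewrite /g; apply: is_derive_eq; rewrite /GRing.scale/= ; ring.
have -> : f b - f a - f1 a * (b - a) = g b - g a by rewrite /g; ring.
rewrite expr2 mulrA.
apply: (mvt_bound dg) (lexx _) => x xa.
have := mvt_bound df1 bf (le_trans xa ba) => /le_trans; apply.
rewrite ler_wpM2l// (le_trans _ (bf a _))//.
by rewrite subrr normr0 (le_trans _ ba).
Qed.

Lemma taylor3_bound f (f1 f2 f3 : R -> R) a r M : (forall x : R, is_derive x (1 : R) f (f1 x)) ->
  (forall x : R, is_derive x (1 : R) f1 (f2 x)) -> (forall x : R, is_derive x (1 : R) f2 (f3 x)) ->
  (forall x, `|x - a| <= r -> `|f3 x| <= M) ->
  forall b, `|b - a| <= r ->
  `|f b - f a - f1 a * (b - a) - f2 a * (b - a) ^+ 2 / 2| <= M * `|b - a| ^+ 3.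
Proof.
move=> df df1 df2 bf b ba.
pose g x := f x - f1 a * x - f2 a * (x - a) ^+ 2 / 2.
have dg x : is_derive x (1 : R) g (f1 x - f1 a - f2 a * (x - a)).
  rewrite /g; apply: is_derive_eq; rewrite /GRing.scale/=; by field.
rewrite [X in `|X|](_ : _ = g b - g a); last by rewrite /g; field.
rewrite exprSr mulrA.
apply: (mvt_bound dg) (lexx _) => x xa.
have := taylor2_bound df1 df2 bf (le_trans xa ba) => /le_trans; apply.
rewrite ler_wpM2l ?lerXn2r ?nnegrE// (le_trans _ (bf a _))//.
by rewrite subrr normr0 (le_trans _ ba).
Qed.

End taylor.

(** * The heat equation for the normal distribution function *)

Section gaussian_taylor.
Context {R : realType}.
Implicit Types (x y z : R).

Notation phi := (normal_pdf (0 : R) 1).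
Notation Phi := (@gauss_cdf R).

Lemma normal_pdf01E x : phi x = normal_peak 1 * expR (- (x ^+ 2 / 2)).
Proof. by rewrite normal_pdfE ?oner_eq0// /normal_fun subr0 expr1n mulNr. Qed.

(** A polynomial of degree at most 4 times the density is therefore bounded.  The
    weight comes from exp t = exp (t / 2) ^ 2 and exp (t / 2) >= 1 + t / 2 at
    t = x^2 / 2. *)
Lemma normal_pdf01_bound x : (1 + x ^+ 2 / 4) ^+ 2 * phi x <= 1.
Proof.
have c1 : normal_peak (1 : R) <= 1.
  have pi1 : 1 <= (pi : R) *+ 2 by rewrite mulr2n; have := pi_ge2 R; lra.
  rewrite /normal_peak expr1n mul1r invf_le1 ?sqrtr_gt0 ?(lt_le_trans ltr01)//.
  by rewrite -[leLHS]sqrtr1 ler_wsqrtr.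
have e1 : (1 + x ^+ 2 / 4) ^+ 2 <= expR (x ^+ 2 / 2).
  rewrite (_ : x ^+ 2 / 2 = 2%:R * (x ^+ 2 / 4)); last by field.
  rewrite expRM_natl lerXn2r ?nnegrE ?expR_ge0 ?expR_ge1Dx//.
  by rewrite addr_ge0// divr_ge0// sqr_ge0.
rewrite normal_pdf01E mulrCA -[leRHS]mulr1.
apply: ler_pM => //; first exact: normal_peak_ge0.
  by rewrite mulr_ge0 ?expR_ge0 ?sqr_ge0.
by rewrite expRN ler_pdivrMr ?expR_gt0// mul1r.
Qed.

Let phi_bound (g : R) x C : 0 <= C -> `|g| <= C * (1 + x ^+ 2 / 4) ^+ 2 ->
  `|g * phi x| <= C.
Proof.
move=> C0 gC; rewrite normrM (ger0_norm (normal_pdf_ge0 _ _ _)).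
apply: (@le_trans _ _ (C * (1 + x ^+ 2 / 4) ^+ 2 * phi x)).
  by rewrite ler_wpM2r ?normal_pdf_ge0.
by rewrite -mulrA ler_piMr// normal_pdf01_bound.
Qed.

Lemma is_derive_normal_pdf01 x : is_derive x (1 : R) phi (- x * phi x).
Proof.
have -> : phi = (fun x => normal_peak 1 * expR (- (x ^+ 2 / 2))).
  by apply/funext => y; exact: normal_pdf01E.
have dq : is_derive x (1 : R) (fun y : R => - (y ^+ 2 / 2)) (- x).
  by apply: is_derive_eq; rewrite /GRing.scale/=; field.
have de : is_derive x (1 : R) (expR \o (fun y : R => - (y ^+ 2 / 2)))
    (expR (- (x ^+ 2 / 2)) * - x).
  by apply: is_derive1_comp.
rewrite -[X in is_derive _ _ X]/(cst (normal_peak 1) * (expR \o (fun y : R => - (y ^+ 2 / 2)))).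
by apply: is_derive_eq; rewrite /GRing.scale/=; ring.
Qed.

Lemma gauss_cdf_taylor3 z h :
  `|Phi (z + h) - Phi z - phi z * h + z * phi z * h ^+ 2 / 2| <= 2 * `|h| ^+ 3.
Proof.
have d2 x : is_derive x (1 : R) (fun y => - y * phi y) ((x ^+ 2 - 1) * phi x).
  have dp := is_derive_normal_pdf01 x.
  rewrite -[X in is_derive _ _ X]/(-%R * phi).
  by apply: is_derive_eq; rewrite /GRing.scale/=; ring.
have b3 x : `|x - z| <= `|h| -> `|(x ^+ 2 - 1) * phi x| <= 2.
  move=> _; apply: phi_bound => //; rewrite ler_norml; apply/andP; split.
    by have := sqr_ge0 x; nra.
  by have := sqr_ge0 x; nra.
have := @taylor3_bound _ _ _ _ _ _ _ _ (@is_derive_gauss_cdf R)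
  is_derive_normal_pdf01 d2 b3 (z + h).
rewrite [z + h]addrC addrK => /(_ (lexx _)).
by rewrite !mulNr opprK.
Qed.

Let phi_scale_bound l z : 0 < l -> `|z ^+ 3 * l * phi (l * z)| <= 8 * l ^- 2.
Proof.
move=> l0; rewrite (_ : z ^+ 3 * l * phi (l * z) =
    l ^- 2 * ((l * z) ^+ 3 * phi (l * z))); last by field; rewrite gt_eqF.
rewrite normrM gtr0_norm ?invr_gt0 ?exprn_gt0// [leRHS]mulrC.
rewrite ler_wpM2l ?invr_ge0 ?exprn_ge0 ?(ltW l0)//.
apply: phi_bound => //; rewrite normrX -(real_normK (num_real (l * z))).
have := normr_ge0 (l * z); move: `|l * z| => u u0.
suff : u ^+ 3 <= (u ^+ 4 + u ^+ 2) / 2 by have := sqr_ge0 u; nra.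
by have := sqr_ge0 (u * (u - 1)); nra.
Qed.

(** The heat equation with a quadratic remainder.  In the variance variable,
    u(v, y) = Phi (y / sqrt v) has derivative - z phi(z) / (2 v) at z = y / sqrt v,
    which is half its second derivative in y.  By scaling, u(v + s, y) equals
    Phi (l z) with l = sqrt (v / (v + s)), so it suffices to expand in l around 1;
    the remainder is uniform in z because z^3 phi(l z) is O(l^(-3)). *)
Lemma gauss_cdf_time v s y : 0 < v -> 0 <= s -> let z := y / Num.sqrt v in
  `|Phi (y / Num.sqrt (v + s)) - Phi z + s / (2 * v) * (z * phi z)|
    <= 10 * (s / v) ^+ 2.
Proof.
move=> v0 s0; set z := y / Num.sqrt v; cbv zeta.
set r := s / v.
have r0 : 0 <= r by rewrite divr_ge0// ltW.
have sv0 : 0 < Num.sqrt v by rewrite sqrtr_gt0.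
have svs0 : 0 < Num.sqrt (v + s) by rewrite sqrtr_gt0 ltr_pwDl.
pose l := Num.sqrt v / Num.sqrt (v + s).
have l0 : 0 < l by rewrite divr_gt0.
have l2 : l ^+ 2 * (1 + r) = 1.
  rewrite /l /r expr_div_n !sqr_sqrtr ?addr_ge0// ?ltW//.
  by field; rewrite ?gt_eqF// ltr_pwDl.
have l1 : l <= 1 by nra.
have -> : y / Num.sqrt (v + s) = l * z.
  by rewrite /l /z; field; rewrite !gt_eqF.
have -> : s / (2 * v) = r / 2 by rewrite /r; field; rewrite gt_eqF.
clearbody z r l.
have dl x : is_derive x (1 : R) (fun x => Phi (x * z)) (z * phi (x * z)).
  have dlin : is_derive x (1 : R) (fun x : R => x * z) z.
    by apply: is_derive_eq; rewrite /GRing.scale/=; ring.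
  rewrite mulrC; apply: (is_derive1_comp (g := fun x : R => x * z)).
  exact: is_derive_gauss_cdf.
have dl2 x : is_derive x (1 : R) (fun x => z * phi (x * z))
    (- (z ^+ 3 * x * phi (x * z))).
  have dlin : is_derive x (1 : R) (fun x : R => x * z) z.
    by apply: is_derive_eq; rewrite /GRing.scale/=; ring.
  have dc : is_derive x (1 : R) (phi \o (fun x : R => x * z))
      (- (x * z) * phi (x * z) * z).
    apply: (is_derive1_comp (g := fun x : R => x * z)).
    exact: is_derive_normal_pdf01.
  rewrite -[X in is_derive _ _ X]/(cst z * (phi \o (fun x : R => x * z))).
  by apply: is_derive_eq; rewrite /GRing.scale/=; ring.
have bl x : `|x - 1| <= 1 - l -> `|- (z ^+ 3 * x * phi (x * z))| <= 8 * l ^- 2.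
  rewrite ler_norml => /andP[lx _]; have {}lx : l <= x by lra.
  have x0 : 0 < x by apply: lt_le_trans lx.
  rewrite normrN (le_trans (phi_scale_bound _ x0))//.
  rewrite ler_pM2l// lef_pV2 ?posrE ?exprn_gt0//.
  by rewrite lerXn2r ?nnegrE ?(ltW l0) ?(ltW x0).
have := taylor2_bound dl dl2 bl (b := l).
rewrite distrC ger0_norm ?subr_ge0// => /(_ (lexx _)).
rewrite !mul1r => T2.
have lr : (1 + l) * (1 - l) = r * l ^+ 2 by nra.
have l1r : 1 - l <= r * l ^+ 2.
  by rewrite -lr ler_peMl ?subr_ge0// lerDl ltW.
have l1r' : r * l ^+ 2 <= r * l by rewrite ler_wpM2l// expr2 ler_piMl// ltW.
(* The factor l^(-2) is absorbed by 1 - l <= r l. *)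
have T2' : 8 * l ^- 2 * (1 - l) ^+ 2 <= 8 * r ^+ 2.
  rewrite -mulrA ler_pM2l// mulrC ler_pdivrMr ?exprn_gt0//.
  rewrite -exprMn lerXn2r ?nnegrE ?subr_ge0 ?mulr_ge0 ?(ltW l0)//.
  exact: le_trans l1r'.
have Z2 : `|z * phi z| <= 2.
  apply: phi_bound => //; rewrite -(real_normK (num_real z)).
  by have := normr_ge0 z; move: `|z| => u u0; have := sqr_ge0 (u - 1); nra.
have L2 : `|l - 1 + r / 2| <= r ^+ 2.
  have E : (l - 1 + r / 2) * (1 + l) = r * (1 - l) * (1 + 2 * l) / 2.
    rewrite (_ : _ * (1 + l) = r / 2 * (1 + l) - (1 + l) * (1 - l)).
      by rewrite lr; lra.
    by ring.
  have E0 : 0 <= r * (1 - l) * (1 + 2 * l) / 2.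
    by rewrite !mulr_ge0 ?subr_ge0 ?addr_ge0 ?mulr_ge0// ltW.
  have E1 : r * (1 - l) * (1 + 2 * l) / 2 <= r ^+ 2 * (1 + l).
    have h : r * (1 - l) <= r ^+ 2 * l.
      by rewrite expr2 -mulrA ler_wpM2l// (le_trans l1r).
    have l12 : 0 <= 1 + 2 * l by rewrite addr_ge0 ?mulr_ge0 ?(ltW l0).
    have := ler_wpM2r l12 h; have := sqr_ge0 r; nra.
  have l10 : 0 < 1 + l by rewrite addr_gt0.
  rewrite ger0_norm; first by rewrite -(ler_pM2r l10) E.
  by rewrite -(pmulr_lge0 _ l10) E.
rewrite (_ : _ + _ = (Phi (l * z) - Phi z - z * phi z * (l - 1)) +
  (l - 1 + r / 2) * (z * phi z)); last by ring.
rewrite (le_trans (ler_normD _ _))//.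
rewrite (_ : 10 * r ^+ 2 = 8 * r ^+ 2 + r ^+ 2 * 2); last by ring.
rewrite lerD//; first exact: le_trans T2'.
by rewrite normrM ler_pM.
Qed.

End gaussian_taylor.

(** * Random walks with finitely many step values *)

Section random_walk.
Context {R : realType} {I : finType}.
Implicit Types (p x : I -> R) (f g : R -> R).

(** The transition operator of the random walk with steps [x a] of probability
    [p a]: the [n]-th iterate at [y] is the expectation of [f] at the position
    reached after [n] steps from [y]. *)
Definition walk_step p x f (y : R) : R := \sum_a p a * f (y + x a).

Notation Phi := (@gauss_cdf R).

Lemma le_iter_walk p x n f g : (forall a, 0 <= p a) -> (forall y, f y <= g y) ->
  forall y, iter n (walk_step p x) f y <= iter n (walk_step p x) g y.
Proof.
move=> p0 fg; elim: n => [//|n IH] y; rewrite !iterS.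
by apply: ler_sum => a _; exact: ler_wpM2l.
Qed.

Lemma iter_walk_affine p x n f (c d : R) : \sum_a p a = 1 ->
  forall y, iter n (walk_step p x) (fun z => c * f z + d) y =
    c * iter n (walk_step p x) f y + d.
Proof.
move=> p1; elim: n => [//|n IH] y; rewrite !iterS /walk_step mulr_sumr.
rewrite -[X in _ + X]mul1r -p1 mulr_suml -big_split; apply: eq_bigr => a _ /=.
by rewrite IH; ring.
Qed.

(** A Markov operator is a contraction for the uniform distance; this is what
    keeps the one-step errors of the Lindeberg argument additive. *)
Lemma iter_walk_dist p x n f g (e : R) : (forall a, 0 <= p a) ->
  \sum_a p a = 1 -> (forall y, `|f y - g y| <= e) ->
  forall y, `|iter n (walk_step p x) f y - iter n (walk_step p x) g y| <= e.
Proof.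
move=> p0 p1 fg y; have shift h d z := iter_walk_affine x n h 1 d p1 z.
rewrite ler_distl; apply/andP; split.
  rewrite -[X in X - e]mul1r -shift; apply: le_iter_walk => // z.
  by have := fg z; rewrite ler_distl mul1r => /andP[].
rewrite -[X in X + e]mul1r -shift; apply: le_iter_walk => // z.
by have := fg z; rewrite ler_distl mul1r => /andP[].
Qed.

Lemma iter_walk_sqr p x n : \sum_a p a = 1 -> \sum_a p a * x a = 0 ->
  forall y, iter n (walk_step p x) (fun z => z ^+ 2) y =
    y ^+ 2 + n%:R * \sum_a p a * x a ^+ 2.
Proof.
move=> p1 px0; set s := \sum_a p a * x a ^+ 2.
elim: n => [|n IH] y; first by rewrite mul0r addr0.
rewrite iterS /walk_step; under eq_bigr => a _ do rewrite IH.
rewrite (eq_bigr (fun a => (y ^+ 2 + n%:R * s) * p a + 2 * y * (p a * x a) +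
  p a * x a ^+ 2)); last by move=> a _; ring.
rewrite !big_split/= -!mulr_sumr p1 px0 -/s -natr1; ring.
Qed.

(** Chebyshev's inequality for a centred walk: the indicator lies below
    y^2 / r^2, whose iterate is known exactly. *)
Lemma iter_walk_chebyshev p x n (r : R) : (forall a, 0 <= p a) ->
  \sum_a p a = 1 -> \sum_a p a * x a = 0 -> 0 < r ->
  iter n (walk_step p x) (fun y => (r <= `|y|)%R%:R) 0 <=
    n%:R * (\sum_a p a * x a ^+ 2) / r ^+ 2.
Proof.
move=> p0 p1 px0 r0.
have -> : n%:R * (\sum_a p a * x a ^+ 2) / r ^+ 2 =
    iter n (walk_step p x) (fun z => r ^- 2 * z ^+ 2 + 0) 0.
  rewrite iter_walk_affine// iter_walk_sqr//; field.
  by rewrite gt_eqF.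
apply: le_iter_walk => // y; rewrite addr0 mulrC ler_pdivlMr ?exprn_gt0//.
have [ry|_] := boolP (r <= `|y|); last by rewrite mul0r sqr_ge0.
by rewrite mul1r -(real_normK (num_real y)) lerXn2r ?nnegrE// ltW.
Qed.

(** One Lindeberg step: expanding Phi to third order in the step, the linear term
    averages to 0 and the quadratic one to s / 2 times the second derivative,
    which by the heat equation is the effect of raising the variance by s. *)
Lemma walk_step_gauss p x (b w v t : R) : (forall a, 0 <= p a) ->
  \sum_a p a = 1 -> \sum_a p a * x a = 0 -> (forall a, `|x a| <= b) ->
  0 < w -> w ^+ 2 <= v ->
  let s := \sum_a p a * x a ^+ 2 in
  forall y, `|walk_step p x (fun z => Phi ((t - z) / Num.sqrt v)) y -
    Phi ((t - y) / Num.sqrt (v + s))| <= 2 * b * s / w ^+ 3 + 10 * s ^+ 2 / w ^+ 4.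
Proof.
move=> p0 p1 px0 xb w0 wv s y.
have v0 : 0 < v by apply: lt_le_trans wv; rewrite exprn_gt0.
have s0 : 0 <= s by apply: sumr_ge0 => a _; rewrite mulr_ge0 ?sqr_ge0.
set u := Num.sqrt v; have u0 : 0 < u by rewrite sqrtr_gt0.
have wu : w <= u by rewrite -(ger0_norm (ltW w0)) -sqrtr_sqr ler_wsqrtr.
have u2 : u ^+ 2 = v by rewrite sqr_sqrtr// ltW.
have time := gauss_cdf_time (t - y) v0 s0.
set z := (t - y) / u in time *.
set D := z * normal_pdf 0 1 z in time *.
have space : `|walk_step p x (fun z => Phi ((t - z) / u)) y -
    (Phi z - s / (2 * v) * D)| <= 2 * b * s / w ^+ 3.
  have -> : walk_step p x (fun z => Phi ((t - z) / u)) y -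
      (Phi z - s / (2 * v) * D) = \sum_a p a * (Phi (z + - (x a / u)) - Phi z
        - normal_pdf 0 1 z * - (x a / u) + D * (- (x a / u)) ^+ 2 / 2).
    rewrite [RHS](eq_bigr (fun a => p a * Phi ((t - (y + x a)) / u) -
      Phi z * p a + normal_pdf 0 1 z / u * (p a * x a) +
      D / (2 * v) * (p a * x a ^+ 2))); last first.
      move=> a _; rewrite -u2 (_ : z + - (x a / u) = (t - (y + x a)) / u); last first.
        by rewrite /z; field; rewrite gt_eqF.
      by field; rewrite gt_eqF.
    rewrite !big_split/= -!mulr_sumr sumrN -mulr_sumr p1 px0 -/s.
    by rewrite /walk_step; ring.
  apply: le_trans (ler_norm_sum _ _ _) _.
  rewrite /s mulr_sumr mulr_suml; apply: ler_sum => a _.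
  rewrite normrM (ger0_norm (p0 a)).
  rewrite (_ : 2 * b * (p a * x a ^+ 2) / w ^+ 3 =
    p a * (2 * (b * x a ^+ 2 / w ^+ 3))); last by ring.
  apply: ler_wpM2l => //; apply: le_trans (gauss_cdf_taylor3 _ _) _.
  rewrite ler_pM2l// normrN normrM exprMn normrV ?unitfE ?gt_eqF//.
  rewrite (gtr0_norm u0) exprVn; apply: ler_pM => //.
  - by rewrite invr_ge0 exprn_ge0// ltW.
  - by rewrite exprS -normrX (ger0_norm (sqr_ge0 _)) ler_wpM2r ?sqr_ge0.
  - by rewrite lef_pV2 ?posrE ?exprn_gt0// lerXn2r ?nnegrE// ltW.
have time' : 10 * (s / v) ^+ 2 <= 10 * s ^+ 2 / w ^+ 4.
  rewrite -mulrA ler_pM2l// expr_div_n ler_wpM2l ?sqr_ge0//.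
  rewrite lef_pV2 ?posrE ?exprn_gt0// (_ : w ^+ 4 = (w ^+ 2) ^+ 2); last by ring.
  by rewrite lerXn2r ?nnegrE ?sqr_ge0// ltW.
rewrite (_ : _ - _ = (walk_step p x (fun z => Phi ((t - z) / u)) y -
    (Phi z - s / (2 * v) * D)) - (Phi ((t - y) / Num.sqrt (v + s)) - Phi z +
    s / (2 * v) * D)); last by ring.
by rewrite (le_trans (ler_normB _ _))// lerD// (le_trans time).
Qed.

(** The one-step errors telescope: each of the [n] steps is traded for an increase
    of the Gaussian variance, which stays above w^2 throughout. *)
Lemma iter_walk_gauss p x (b w v t : R) n : (forall a, 0 <= p a) ->
  \sum_a p a = 1 -> \sum_a p a * x a = 0 -> (forall a, `|x a| <= b) ->
  0 < w -> w ^+ 2 <= v ->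
  let s := \sum_a p a * x a ^+ 2 in
  forall y, `|iter n (walk_step p x) (fun z => Phi ((t - z) / Num.sqrt v)) y -
    Phi ((t - y) / Num.sqrt (v + n%:R * s))| <=
    n%:R * (2 * b * s / w ^+ 3 + 10 * s ^+ 2 / w ^+ 4).
Proof.
move=> p0 p1 px0 xb w0 + s y; set e := (X in _ <= _ * X).
have s0 : 0 <= s by apply: sumr_ge0 => a _; rewrite mulr_ge0 ?sqr_ge0.
elim: n v => [|n IH] v wv.
  by rewrite !mul0r addr0 subrr normr0.
rewrite iterSr -natr1 [_ * s]mulrDl [_ * e]mulrDl !mul1r.
have wvs : w ^+ 2 <= v + s by rewrite (le_trans wv)// lerDl.
have := IH (v + s) wvs; rewrite -addrA [s + _]addrC => IHs.
have := iter_walk_dist x n p0 p1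
  (walk_step_gauss t p0 p1 px0 xb w0 wv) y.
move=> h; rewrite [leRHS]addrC; apply: le_trans (lerD h IHs).
exact: ler_distD.
Qed.

(** The indicator of a half line is caught between two shifted Gaussian ramps.
    The shift is d and the ramp has standard deviation d^2, so that the ramp is
    within 1 - Phi (1 / d) of 0 or 1 at distance d from its centre, and both
    scales vanish with d. *)
Lemma iter_walk_indic_bounds p x n (t d : R) : (forall a, 0 <= p a) ->
  \sum_a p a = 1 -> 0 < d ->
  let G c := iter n (walk_step p x)
    (fun y => Phi ((t + c - y) / Num.sqrt (c ^+ 4))) 0 in
  let A := iter n (walk_step p x) (fun y => (y <= t)%R%:R) 0 in
  G (- d) - Phi (- d^-1) <= A /\ A <= G d + (1 - Phi d^-1).
Proof.
move=> p0 p1 d0; cbv zeta.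
have s4 : Num.sqrt (d ^+ 4) = d * d.
  rewrite (_ : d ^+ 4 = (d * d) ^+ 2); last by ring.
  by rewrite sqrtr_sqr ger0_norm ?mulr_ge0 ?ltW.
have s4N : Num.sqrt ((- d) ^+ 4) = d * d by rewrite -s4; congr Num.sqrt; ring.
have dd0 : 0 < d * d by rewrite mulr_gt0.
have d1 : d^-1 * (d * d) = d by rewrite mulrA mulVf ?mul1r// gt_eqF.
split.
  rewrite -[X in X - _ <= _]mul1r -iter_walk_affine//; apply: le_iter_walk => // y.
  have [yt|ty] := leP y t.
    by rewrite mul1r lerBlDr (le_trans (gauss_cdf_le1 _))// lerDl gauss_cdf_ge0.
  rewrite mul1r subr_le0; apply: le_gauss_cdf.
  by rewrite s4N ler_pdivrMr// mulNr d1 addrAC gerDr subr_le0 ltW.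
rewrite -[X in X + (1 - _)]mul1r -iter_walk_affine//; apply: le_iter_walk => // y.
have [yt|_] := leP y t; last first.
  by rewrite mul1r addr_ge0 ?gauss_cdf_ge0// subr_ge0 gauss_cdf_le1.
rewrite mul1r addrCA lerDl subr_ge0; apply: le_gauss_cdf.
by rewrite s4 ler_pdivlMr// d1 addrAC lerDr subr_ge0.
Qed.

End random_walk.

(** * Central limit theorem for triangular arrays *)

Section random_walk_clt.
Context {R : realType} {I : finType}.
Notation Phi := (@gauss_cdf R).

Let Phi_shift (sigma t : R) : 0 < sigma ->
  Phi ((t + d) / Num.sqrt (d ^+ 4 + sigma ^+ 2)) @[d --> (0 : R)] -->
  Phi (t / sigma).
Proof.
move=> s0.
apply: continuous_cvg; first exact: continuous_gauss_cdf.
have e : t / sigma = (t + 0) / Num.sqrt (0 ^+ 4 + sigma ^+ 2).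
  by rewrite addr0 expr0n add0r sqrtr_sqr gtr0_norm.
rewrite e; apply: cvgM; first by apply: cvgD; [exact: cvg_cst|exact: cvg_id].
apply: cvgV; first by rewrite expr0n add0r sqrtr_sqr gtr0_norm// gt_eqF.
apply: continuous_cvg; first exact: sqrt_continuous.
apply: cvgD; last exact: cvg_cst.
exact: exprn_continuous.
Qed.

Variables (p x : nat -> I -> R) (b t : nat -> R) (sigma tlim : R).
Hypothesis sigma0 : 0 < sigma.
Hypothesis px : \forall n \near \oo, [/\ forall a, 0 <= p n a,
  \sum_a p n a = 1, \sum_a p n a * x n a = 0 & forall a, `|x n a| <= b n].
Hypothesis b0 : b n @[n --> \oo] --> (0 : R).
Hypothesis xsigma :
  n%:R * \sum_a p n a * x n a ^+ 2 @[n --> \oo] --> sigma ^+ 2.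
Hypothesis tcvg : t n @[n --> \oo] --> tlim.

Let iter_walk_gauss_cvg (d : R) : d != 0 ->
  iter n (walk_step (p n) (x n))
    (fun y => Phi ((t n + d - y) / Num.sqrt (d ^+ 4))) 0 @[n --> \oo] -->
  Phi ((tlim + d) / Num.sqrt (d ^+ 4 + sigma ^+ 2)).
Proof.
move=> d0; pose w := d ^+ 2.
have w0 : 0 < w by rewrite exprn_even_gt0.
pose s n := \sum_a p n a * x n a ^+ 2.
have s0 : s n @[n --> \oo] --> (0 : R).
  apply: (@squeeze_cvgr _ _ _ _ (cst 0) (fun n => b n ^+ 2)).
  - near=> n.
    have [p0 p1 _ xb] : [/\ forall a, 0 <= p n a, \sum_a p n a = 1,
      \sum_a p n a * x n a = 0 & forall a, `|x n a| <= b n] by near: n.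
    rewrite sumr_ge0/= => [|a _]; last by rewrite mulr_ge0 ?sqr_ge0.
    rewrite -[leRHS]mul1r -p1 mulr_suml; apply: ler_sum => a _.
    rewrite ler_wpM2l// -(real_normK (num_real (x n a))).
    by rewrite lerXn2r ?nnegrE// (le_trans _ (xb a)).
  - exact: cvg_cst.
  - rewrite -[X in _ --> X](expr0n R 2).
    apply: (@cvg_comp _ _ _ b (fun y : R => y ^+ 2) _ _ _ b0).
    exact: exprn_continuous.
pose g n := Phi ((t n + d) / Num.sqrt (w ^+ 2 + n%:R * s n)).
pose e n := 2 * b n * (n%:R * s n) / w ^+ 3 + 10 * ((n%:R * s n) * s n) / w ^+ 4.
have d4 : d ^+ 4 = w ^+ 2 by rewrite /w; ring.
have ge : g n @[n --> \oo] --> Phi ((tlim + d) / Num.sqrt (d ^+ 4 + sigma ^+ 2)).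
  apply: (@cvg_comp _ _ _ (fun n => (t n + d) / Num.sqrt (w ^+ 2 + n%:R * s n))
    Phi _ _ _ _ (@continuous_gauss_cdf R _)).
  apply: cvgM; first by apply: cvgD => //; exact: cvg_cst.
  apply: cvgV.
    by rewrite gt_eqF// sqrtr_gt0 d4 addr_gt0// exprn_gt0.
  apply: (@cvg_comp _ _ _ (fun n => w ^+ 2 + n%:R * s n) Num.sqrt _ _ _ _
    (@sqrt_continuous R _)).
  by rewrite d4; apply: cvgD => //; exact: cvg_cst.
have e0 : e n @[n --> \oo] --> (0 : R).
  rewrite (_ : 0 = 2 * 0 * sigma ^+ 2 / w ^+ 3 + 10 * (sigma ^+ 2 * 0) / w ^+ 4);
    last by ring.
  apply: cvgD; (apply: cvgM; last exact: cvg_cst); apply: cvgM => //.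
  - by apply: cvgM => //; exact: cvg_cst.
  - exact: cvg_cst.
  - exact: cvgM.
apply/cvgrPdist_le => _/posnumP[eps].
near=> n.
have [p0 p1 px0 xb] : [/\ forall a, 0 <= p n a, \sum_a p n a = 1,
  \sum_a p n a * x n a = 0 & forall a, `|x n a| <= b n] by near: n.
have := iter_walk_gauss (t n + d) n p0 p1 px0 xb w0 (lexx _) 0.
rewrite subr0 -/(s n) -/(g n).
rewrite (_ : _%:R * (_ + _) = e n); last by rewrite /e; ring.
move=> he.
apply: le_trans (ler_distD (g n) _ _) _.
rewrite [leRHS]splitr lerD//.
  by near: n; move/cvgrPdist_le : ge; apply.
rewrite d4 distrC (le_trans he)//.
apply: le_trans (ler_norm _) _; rewrite -normrN -sub0r.
by near: n; move/cvgrPdist_le : e0; apply.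
Unshelve. all: by end_near. Qed.

(** For a fixed d, Lindeberg's errors n (b s / d^6 + s^2 / d^8) vanish as n grows,
    because b tends to 0, n s to sigma^2 and s <= b^2.  Then d tends to 0 in the
    bounds of [iter_walk_indic_bounds]. *)
Theorem walk_clt :
  iter n (walk_step (p n) (x n)) (fun y => (y <= t n)%R%:R) 0 @[n --> \oo] -->
  Phi (tlim / sigma).
Proof.
apply/cvgrPdist_le => _/posnumP[eps].
set F := fun d : R => Phi ((tlim + d) / Num.sqrt (d ^+ 4 + sigma ^+ 2)).
have invy : (fun d : R => d^-1) @ (0 : R)^'+ --> +oo.
  by apply/cvgrVy; [exact: nbhs_right_gt|exact: cvg_at_right_filter cvg_id].
have oppr0 : (-%R : R -> R) @ (0 : R)^'+ --> (0 : R).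
  by rewrite -[X in _ --> X]oppr0; apply: cvgN; exact: cvg_at_right_filter cvg_id.
have cF : F d @[d --> (0 : R)^'+] --> Phi (tlim / sigma).
  by apply: cvg_at_right_filter; exact: Phi_shift.
have cFN : F (- d) @[d --> (0 : R)^'+] --> Phi (tlim / sigma).
  by apply: (@cvg_comp _ _ _ -%R F _ _ _ oppr0); exact: Phi_shift.
have cPhi : Phi d^-1 @[d --> (0 : R)^'+] --> (1 : R).
  exact: (@cvg_comp _ _ _ (fun d : R => d^-1) Phi _ _ _ invy (@gauss_cdf_cvgy R)).
have cPhiN : Phi (- d^-1) @[d --> (0 : R)^'+] --> (0 : R).
  apply: (@cvg_comp _ _ _ (fun d : R => - d^-1) Phi _ -oo _ _ (@gauss_cdf_cvgNy R)).
  by apply/(cvgNrNy (fun d : R => d^-1)).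
have e3 : 0 < eps%:num / 3 by [].
have /cvgrPdist_le/(_ _ e3) nF := cF.
have /cvgrPdist_le/(_ _ e3) nFN := cFN.
have /cvgrPdist_le/(_ _ e3) nP := cPhi.
have /cvgrPdist_le/(_ _ e3) nPN := cPhiN.
have [d [d0 [F1 [F2 [P1 P2]]]]] := filter_ex (filterI (nbhs_right_gt (0 : R))
  (filterI nF (filterI nFN (filterI nP nPN)))).
have dn0 : d != 0 by rewrite gt_eqF.
have dN0 : - d != 0 by rewrite oppr_eq0.
pose G n (d : R) := iter n (walk_step (p n) (x n))
  (fun y => Phi ((t n + d - y) / Num.sqrt (d ^+ 4))) 0.
have /cvgrPdist_le/(_ _ e3) nG1 := iter_walk_gauss_cvg dn0.
have /cvgrPdist_le/(_ _ e3) nG2 := iter_walk_gauss_cvg dN0.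
apply: filterS3 px nG1 nG2 => n [p0 p1 _ _].
rewrite -/(F d) -/(F (- d)) -/(G n d) -/(G n (- d)) => G1 G2.
have [lb ub] := iter_walk_indic_bounds (x n) n (t n) p0 p1 d0.
rewrite -/(G n d) -/(G n (- d)) in lb ub.
move: (iter _ _ _ _) lb ub => A lb ub.
move: F1 F2 P1 P2 G1 G2; clearbody F G.
move: (F d) (F (- d)) (G n d) (G n (- d)) (Phi d^-1) (Phi (- d^-1)) lb ub.
move: (Phi _) eps%:num => f0 e f1 f2 g1 g2 h1 h2; clear; rewrite !ler_norml.
move=> lb ub.
move=> /andP[? ?] /andP[? ?] /andP[? ?] /andP[? ?] /andP[? ?] /andP[? ?].
by apply/andP; split; lra.
Qed.
End random_walk_clt.

(** * The law of a sum of i.i.d. variables with finitely many values *)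

Section iid_walk.
Context d (T : measurableType d) (R : realType) (P : probability T R).
Context d' (T' : measurableType d') (X : nat -> {RV P >-> T'}) (Y : {RV P >-> T'}).
Context (I : finType) (c : T' -> I) (x : I -> R) (A : pred R).
Hypothesis Xiid : iid_copies X Y.
Hypothesis mc : forall a, measurable (c @^-1` [set a]).

Let p a : R := fine (P (Y @^-1` (c @^-1` [set a]))).

Let pE i a : P (X i @^-1` (c @^-1` [set a])) = (p a)%:E.
Proof.
rewrite /p fineK; last by rewrite fin_num_measure//; exact: measurable_funPTI.
exact: (Xiid.2 i _ (mc a)).
Qed.

Let level j (y : R) := [set w | A (y + \sum_(i < j) x (c (X i w)))].

Let levelS j y : level j.+1 y =
  \bigcup_(a in [set: I]) (level j (y + x a) `&` X j @^-1` (c @^-1` [set a])).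
Proof.
apply/seteqP; split=> [w|w [a _ []]]; rewrite /level/= big_ord_recr/=.
  by move=> Aw; exists (c (X j w)) => //; split => //=; rewrite addrAC -addrA.
by move=> + ca; rewrite ca addrAC -addrA.
Qed.

Let measurable_level j y : measurable (level j y).
Proof.
elim: j y => [|j IH] y.
  rewrite /level; under eq_set do rewrite big_ord0 addr0.
  by case: (A y); [rewrite set_true|rewrite set_false].
rewrite levelS; apply: fin_bigcup_measurable => // a _; apply: measurableI => //.
exact: measurable_funPTI.
Qed.

Let future (J : {fset nat}) (B : nat -> set T') :=
  \bigcap_(i in [set` J]) (X i @^-1` B i).

Let measurable_future J B : (forall i, measurable (B i)) -> measurable (future J B).
Proof.
by move=> mB; apply: fin_bigcap_measurable => // i _; exact: measurable_funPTI.
Qed.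

Let futureP J B : (forall i, measurable (B i)) ->
  P (future J B) = (\prod_(i <- J) fine (P (X i @^-1` B i)))%:E.
Proof.
move=> mB; rewrite Xiid.1// (big_morph EFin EFinM erefl).
by apply: eq_bigr => i _; rewrite fineK// fin_num_measure//; exact: measurable_funPTI.
Qed.

(** The event on the first [j] variables is intersected with an event on later
    variables, because the induction on [j] consumes the value of the [j]-th
    variable as an extra constraint of the latter kind. *)
Let level_future j y J B : (forall i, measurable (B i)) ->
    (forall i, i \in J -> (j <= i)%N) ->
  P (level j y `&` future J B) =
  (iter j (walk_step p x) (fun y => (A y)%:R) y *
    \prod_(i <- J) fine (P (X i @^-1` B i)))%:E.
Proof.
elim: j y J B => [|j IH] y J B mB Jj.
  rewrite /level /=; under eq_set do rewrite big_ord0 addr0.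
  case: (A y); first by rewrite set_true setTI futureP//= mul1r.
  by rewrite set_false set0I measure0/= mul0r.
have jJ : j \notin J by apply/negP => /Jj; rewrite ltnn.
pose B' a i := if i == j then c @^-1` [set a] else B i.
have mB' a i : measurable (B' a i) by rewrite /B'; case: ifP.
have futureS a : X j @^-1` (c @^-1` [set a]) `&` future J B =
    future (j |` J)%fset (B' a).
  apply/seteqP; split=> [w [wj wJ] i|w wJ].
    rewrite /= inE in_fset1 /B'; have [->//|_ /= iJ] := eqVneq i j.
    exact: wJ.
  split; first by have := wJ j; rewrite /= !inE eqxx /B' eqxx; apply.
  move=> i /= iJ; have := wJ i; rewrite /= !inE iJ orbT /B'.
  have [ij|_] := eqVneq i j; first by rewrite ij (negbTE jJ) in iJ.
  exact.
rewrite levelS setI_bigcupl.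
rewrite (eq_bigcupr (fun a _ => esym (setIA _ _ _))).
under eq_bigcupr => a _ do rewrite futureS.
rewrite measure_fin_bigcup//=; last 2 first.
- apply/trivIsetP => a b _ _ ab; apply/seteqP; split=> // w [[_ wa] [_ wb]].
  have := wa j; have := wb j; rewrite /= !inE eqxx /B' eqxx => /(_ isT) wb' /(_ isT) wa'.
  by move/eqP : ab; apply; rewrite -wa' -wb'.
- by move=> a _; apply: measurableI => //; exact: measurable_future.
rewrite (fsbigE (index_enum I))//; last 2 first.
- exact: index_enum_uniq.
- by move=> a _; rewrite mem_index_enum.
under eq_bigl => a do rewrite in_setT.
rewrite /= {1}/walk_step mulr_suml -sumEFin; apply: eq_bigr => a _.
rewrite IH//; last first.
  by move=> i; rewrite !inE => /orP[/eqP->//|/Jj/ltnW].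
rewrite big_fsetU1//= {1}/B' eqxx pE /=; congr EFin.
rewrite mulrCA mulrA; congr (_ * _); apply: eq_big_seq => i iJ.
rewrite /B'; case: eqVneq => // ij.
by rewrite ij (negbTE jJ) in iJ.
Qed.

(** Independence enters the limit theorems only through this identity, which
    reduces them to estimates on the transition operator. *)
Lemma iid_walk_prob n :
  P [set w | A (\sum_(i < n) x (c (X i w)))] =
  (iter n (walk_step p x) (fun y => (A y)%:R) 0)%:E.
Proof.
have := @level_future n 0 fset0 (fun=> setT) (fun=> measurableT).
rewrite /future set_fset0 bigcap_set0 setIT big_seq_fset0 mulr1.
by rewrite /level; under eq_set do rewrite add0r; apply.
Qed.

End iid_walk.

(** * Exceedance counts *)

Section tail_events.
Context d (T : measurableType d) (R : realType) (P : probability T R).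
Context (S : {RV P >-> nat}) (S_ : nat -> {RV P >-> nat}).
Hypothesis iidS : iid_copies S_ S.

Let mS (X : {RV P >-> nat}) (A : set nat) : measurable (X @^-1` A).
Proof. exact: measurable_funPTI. Qed.

Lemma fine_measureK (A : set T) : measurable A -> (fine (P A))%:E = P A.
Proof. by move=> mA; rewrite fineK// fin_num_measure. Qed.

Lemma tail_probE l : (tail_prob S l)%:E = P [set w | expR l < (S w)%:R].
Proof. by rewrite fine_measureK//; exact: (mS S [set m | expR l < m%:R]). Qed.

Lemma tail_prob_ge0 l : 0 <= tail_prob S l.
Proof. by rewrite fine_ge0. Qed.

Lemma tail_prob_le1 l : tail_prob S l <= 1.
Proof.
rewrite -lee_fin tail_probE; apply: probability_le1.
exact: (mS S [set m | expR l < m%:R]).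
Qed.

Lemma le_tail_prob l l' : l <= l' -> tail_prob S l' <= tail_prob S l.
Proof.
move=> ll'; rewrite -lee_fin !tail_probE; apply: le_measure; rewrite ?inE.
- exact: (mS S [set m | expR l' < m%:R]).
- exact: (mS S [set m | expR l < m%:R]).
- by move=> w /=; apply: le_lt_trans; rewrite ler_expR.
Qed.

Section levels.
Variables (l l' : R).
Hypothesis ll' : l <= l'.
Let p := tail_prob S l.
Let q := tail_prob S l'.

(** All that the two counts need to know about an observation.  The value
    [(false, true)] has probability 0 when [l <= l']. *)
Definition tail_color (m : nat) : bool * bool :=
  (expR l < m%:R, expR l' < m%:R).

Let prob a : R := fine (P (S @^-1` (tail_color @^-1` [set a]))).

Lemma tail_color_sum (f : bool * bool -> R) : \sum_a prob a * f a =
  (1 - p) * f (false, false) + (p - q) * f (true, false) + q * f (true, true).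
Proof.
have mEl : measurable [set w | expR l < (S w)%:R].
  exact: (mS S [set m | expR l < m%:R]).
have mEl' : measurable [set w | expR l' < (S w)%:R].
  exact: (mS S [set m | expR l' < m%:R]).
have pTT : prob (true, true) = q.
  congr (fine (P _)); apply/seteqP; split=> w; rewrite /tail_color/=.
    by case.
  by move=> h; rewrite h (le_lt_trans _ h) ?ler_expR.
have pFT : prob (false, true) = 0.
  rewrite /prob [X in P X](_ : _ = set0) ?measure0//.
  apply/seteqP; split=> w //; rewrite /tail_color/= => -[+ h].
  by rewrite (le_lt_trans _ h) ?ler_expR.
have pTF : prob (true, false) = p - q.
  apply: EFin_inj; rewrite /prob EFinB !tail_probE fine_measureK//.
  have -> : S @^-1` (tail_color @^-1` [set (true, false)]) =
      [set w | expR l < (S w)%:R] `\` [set w | expR l' < (S w)%:R].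
    apply/seteqP; split=> w; rewrite /tail_color/=.
      by case=> -> ->.
    by move=> [-> /negP/negbTE ->].
  rewrite measureD//; last first.
    by apply: le_lt_trans (ltry 1); exact: probability_le1.
  congr (_ - P _)%E; apply/seteqP; split=> w /=; first by case.
  by move=> h; split=> //; apply: le_lt_trans h; rewrite ler_expR.
have pFF : prob (false, false) = 1 - p.
  apply: EFin_inj; rewrite /prob EFinB tail_probE fine_measureK//.
  rewrite -probability_setC//; congr (P _).
  apply/seteqP; split=> w; rewrite /tail_color/=; first by case=> ->.
  move=> /negP/negbTE h; rewrite h; congr pair.
  by apply: contraFF h => h'; apply: le_lt_trans h'; rewrite ler_expR.
transitivity (\sum_(a : bool) \sum_(b : bool) prob (a, b) * f (a, b)).
  by rewrite pair_bigA; apply: eq_bigr => -[].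
by rewrite !big_bool/= pTT pFT pTF pFF; ring.
Qed.

Lemma tail_color_prob_ge0 a : 0 <= prob a.
Proof. by rewrite fine_ge0. Qed.

Lemma tail_color_prob_sum1 : \sum_a prob a = 1.
Proof.
have := tail_color_sum (fun=> 1); under eq_bigr do rewrite mulr1.
by move=> ->; ring.
Qed.

Section counts.
Variables (u v : R).

Definition centered_color (a : bool * bool) : R :=
  u * a.1%:R + v * a.2%:R - (u * p + v * q).

Lemma centered_color_mean : \sum_a prob a * centered_color a = 0.
Proof. by rewrite tail_color_sum /centered_color/=; ring. Qed.

Lemma centered_color_sqr : \sum_a prob a * centered_color a ^+ 2 =
  u ^+ 2 * (p - q) + (u + v) ^+ 2 * q - (u * p + v * q) ^+ 2.
Proof. by rewrite tail_color_sum /centered_color/=; ring. Qed.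

Lemma centered_color_sum n w : \sum_(i < n) centered_color (tail_color (S_ i w)) =
  n%:R * (u * emp_tail_prob S_ n l w + v * emp_tail_prob S_ n l' w) -
  n%:R * (u * p + v * q).
Proof.
have [->|n0] := eqVneq n 0%N; first by rewrite big_ord0 !mul0r subrr.
have emp m : n%:R * emp_tail_prob S_ n m w = \sum_(i < n) (expR m < (S_ i w)%:R)%R%:R.
  rewrite /emp_tail_prob mulrA divff ?pnatr_eq0// mul1r.
  by apply: eq_bigr => i _; rewrite indicE mem_setE.
rewrite [X in _ = X - _](_ : _ = u * (n%:R * emp_tail_prob S_ n l w) +
  v * (n%:R * emp_tail_prob S_ n l' w)); last by ring.
rewrite !emp /centered_color sumrB big_split/= -!mulr_sumr.
by rewrite sumr_const card_ord mulr_natl.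
Qed.

End counts.

Lemma tail_color_prob n (A : pred R) (x : bool * bool -> R) :
  P [set w | A (\sum_(i < n) x (tail_color (S_ i w)))] =
  (iter n (walk_step prob x) (fun y => (A y)%:R) 0)%:E.
Proof. exact: iid_walk_prob. Qed.

End levels.

(** Chebyshev's inequality, with the binomial variance n p (1 - p) bounded by
    n p. *)
Lemma emp_tail_prob_deviation (l : R) n (r : R) : 0 < r ->
  fine (P [set w | r <= `|n%:R * emp_tail_prob S_ n l w - n%:R * tail_prob S l|])
  <= n%:R * tail_prob S l / r ^+ 2.
Proof.
move=> r0; set x := centered_color l l 1 0.
(* A single count is the case of two equal levels, with weights 1 and 0. *)
have -> : [set w | r <= `|n%:R * emp_tail_prob S_ n l w - n%:R * tail_prob S l|] =
    [set w | r <= `|\sum_(i < n) x (tail_color l l (S_ i w))|].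
  apply/seteqP; split=> w /=; rewrite centered_color_sum !mul1r !mul0r !addr0//.
rewrite (tail_color_prob l l n (fun s => r <= `|s|)) /=.
have p1 := tail_color_prob_sum1 (lexx l).
have x0 := centered_color_mean (lexx l) 1 0.
apply: le_trans (iter_walk_chebyshev _ (tail_color_prob_ge0 l l) p1 x0 r0) _.
rewrite ler_wpM2r ?invr_ge0 ?exprn_ge0 ?(ltW r0)// ler_wpM2l//.
rewrite centered_color_sqr//.
by have := sqr_ge0 (tail_prob S l); lra.
Qed.

End tail_events.

(** * Slutsky lemma and elementary limits *)

Section events.
Context d (T : measurableType d) (R : realType) (P : probability T R).

Lemma fine_prob_le_off (E F G : set T) : measurable E -> measurable F ->
  measurable G -> E `&` G `<=` F -> fine (P E) <= fine (P F) + fine (P (~` G)).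
Proof.
move=> mE mF mG EGF; rewrite -lee_fin EFinD !fine_measureK//; last exact: measurableC.
apply: (@le_trans _ _ (P (F `|` ~` G))); last first.
  by apply: measureU2 => //; exact: measurableC.
apply: le_measure; rewrite ?inE//.
  by apply: measurableU => //; exact: measurableC.
move=> w Ew; have [Gw|Gw] := pselect (G w); [left|by right].
exact: EGF.
Qed.

Lemma measurable_level_le (f : T -> R) (x : R) : measurable_fun [set: T] f ->
  measurable [set w | f w <= x].
Proof.
move=> mf; have := mf measurableT `]-oo, x]%classic (measurable_itv _).
by rewrite setTI; congr measurable; apply/seteqP; split=> w /=; rewrite in_itv.
Qed.

Lemma measurable_level_dist (f : T -> R) (c r : R) : measurable_fun [set: T] f ->
  measurable [set w | `|f w - c| < r].
Proof.
move=> mf.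
have -> : [set w | `|f w - c| < r] = ~` [set w | - `|f w - c| <= - r].
  by apply/seteqP; split=> w /=; rewrite lerN2 ltNge => /negP.
apply: measurableC; apply: measurable_level_le.
by do 2!apply: measurableT_comp => //; exact: measurable_funB.
Qed.

(** Slutsky's argument in multiplicative form: if K is within eta of 1 then
    replacing Z = K Y by Y moves the threshold x by at most eta times its absolute
    value, and F is continuous at x. *)
Lemma slutsky_ratio (Y Z : nat -> T -> R) (F : R -> R) :
  (forall n, measurable_fun [set: T] (Y n)) ->
  (forall n, measurable_fun [set: T] (Z n)) ->
  continuous F ->
  (forall x, fine (P [set w | Z n w <= x]) @[n --> \oo] --> F x) ->
  (forall eta : R, 0 < eta -> eta < 1 -> exists G : nat -> set T,
    [/\ forall n, measurable (G n), fine (P (~` G n)) @[n --> \oo] --> (0 : R) &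
     \forall n \near \oo, forall w, G n w ->
       exists2 K, `|K - 1| <= eta & Z n w = K * Y n w]) ->
  forall x, fine (P [set w | Y n w <= x]) @[n --> \oo] --> F x.
Proof.
move=> mY mZ cF cZ HG x; apply/cvgrPdist_le => e e0.
have e3 : 0 < e / 3 by rewrite divr_gt0.
have shift (s : R) : F (x + eta * s) @[eta --> (0 : R)^'+] --> F x.
  have h : x + eta * s @[eta --> (0 : R)^'+] --> x.
    rewrite -[X in _ --> X]addr0 -[X in _ + X](mul0r s).
    apply: cvgD; first exact: cvg_cst.
    by apply: cvgM; [exact: cvg_at_right_filter cvg_id|exact: cvg_cst].
  exact: (@cvg_comp _ _ _ (fun eta => x + eta * s) F _ _ _ h (cF x)).
have /cvgrPdist_le/(_ _ e3) Fp := shift `|x|.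
have /cvgrPdist_le/(_ _ e3) Fm := shift (- `|x|).
have [eta [eta0 [eta1 [F1 F2]]]] := filter_ex (filterI (nbhs_right_gt (0 : R))
  (filterI (nbhs_right_lt (@ltr01 R)) (filterI Fp Fm))).
have [G [mG cG GK]] := HG eta eta0 eta1.
have /cvgrPdist_le/(_ _ e3) Z1 := cZ (x + eta * `|x|).
have /cvgrPdist_le/(_ _ e3) Z2 := cZ (x + eta * - `|x|).
have /cvgrPdist_le/(_ _ e3) G1 := cG.
apply: filterS2 GK (filterI G1 (filterI Z1 Z2)) => n GK [g [z1 z2]].
have K_bound (K : R) : `|K - 1| <= eta -> 0 < K /\ `|K * x - x| <= eta * `|x|.
  move=> K1; split; first by move: K1; rewrite ler_norml => /andP[]; lra.
  by rewrite -[X in _ - X]mul1r -mulrBl normrM ler_wpM2r.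
have up := @fine_prob_le_off [set w | Y n w <= x]
  [set w | Z n w <= x + eta * `|x|] (G n) (measurable_level_le _ (mY n))
  (measurable_level_le _ (mZ n)) (mG n).
have lo := @fine_prob_le_off [set w | Z n w <= x + eta * - `|x|]
  [set w | Y n w <= x] (G n) (measurable_level_le _ (mZ n))
  (measurable_level_le _ (mY n)) (mG n).
have {}up : fine (P [set w | Y n w <= x]) <=
    fine (P [set w | Z n w <= x + eta * `|x|]) + fine (P (~` G n)).
  apply: up => w [/= Yx] /GK[K /K_bound[K0 Kx] ->].
  have : K * Y n w <= K * x by rewrite ler_pM2l.
  by move: Kx; rewrite ler_norml => /andP[_]; lra.
have {}lo : fine (P [set w | Z n w <= x + eta * - `|x|]) <=
    fine (P [set w | Y n w <= x]) + fine (P (~` G n)).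
  apply: lo => w [/= + /GK[K /K_bound[K0 Kx] Ze]]; rewrite Ze => Yx.
  rewrite -(ler_pM2l K0); move: Kx; rewrite ler_norml => /andP[+ _]; lra.
move: F1 F2 z1 z2 g up lo; rewrite !ler_norml sub0r.
move: (F _) (F _) (F _) (fine _) (fine _) (fine _) (fine _) => f0 f1 f2 a1 a2 a3 a4.
clear.
move=> /andP[? ?] /andP[? ?] /andP[? ?] /andP[? ?] /andP[? ?] ? ?.
by apply/andP; split; lra.
Qed.

End events.

Section exp_limits.
Context {R : realType}.

Lemma cvg_sqrtr_pinfty (N : nat -> R) : N n @[n --> \oo] --> +oo ->
  Num.sqrt (N n) @[n --> \oo] --> +oo.
Proof.
move=> /cvgryPge Noo; apply/cvgryPge => M.
apply: filterS (Noo (M ^+ 2)) => n MN.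
apply: (@le_trans _ _ `|M|); first exact: ler_norm.
by rewrite -sqrtr_sqr ler_wsqrtr.
Qed.

Lemma cvg_inv_sqrtr0 (N : nat -> R) : N n @[n --> \oo] --> +oo ->
  (Num.sqrt (N n))^-1 @[n --> \oo] --> (0 : R).
Proof.
move=> Noo; have sN := cvg_sqrtr_pinfty Noo.
by apply/gtr0_cvgV0 => //; move/cvgryPgt : sN; exact.
Qed.

(** The derivative of the exponential at 0, along x / s. *)
Lemma cvg_expR_increment (x : R) (s : nat -> R) :
  s n @[n --> \oo] --> +oo ->
  s n * (expR (x / s n) - 1) @[n --> \oo] --> x.
Proof.
move=> soo.
have s0 : \forall n \near \oo, 0 < s n by move/cvgryPgt : soo; exact.
have si : (s n)^-1 @[n --> \oo] --> (0 : R) by exact/gtr0_cvgV0.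
have eb : `|x| / s n @[n --> \oo] --> (0 : R).
  by rewrite -[X in _ --> X](mulr0 `|x|); apply: cvgM => //; exact: cvg_cst.
have : expR 1 * (x ^+ 2 / s n) @[n --> \oo] --> (0 : R).
  rewrite -[X in _ --> X](mulr0 (expR 1)); apply: cvgM; first exact: cvg_cst.
  by rewrite -[X in _ --> X](mulr0 (x ^+ 2)); apply: cvgM => //; exact: cvg_cst.
move=> /cvgrPdist_le Q; apply/cvgrPdist_le => e e0.
have /cvgrPdist_le/(_ _ ltr01) eb1 := eb.
apply: filterS3 s0 (Q e e0) eb1 => n sn0.
rewrite !sub0r !normrN (ger0_norm (x := _ / _)) ?divr_ge0 ?(ltW sn0)// => le_e x1.
have bnd y : `|y - 0| <= 1 -> `|expR y| <= expR 1 :> R.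
  rewrite subr0 => y1; rewrite gtr0_norm ?expR_gt0// ler_expR.
  by rewrite (le_trans (ler_norm _)).
have := @taylor2_bound _ expR expR expR 0 1 (expR 1) (@is_derive_expR R)
  (@is_derive_expR R) bnd (x / s n).
rewrite !subr0 expR0 mul1r normrM normfV (gtr0_norm sn0) => /(_ x1) T2.
rewrite distrC (_ : _ - x = s n * (expR (x / s n) - 1 - x / s n)); last first.
  by field; rewrite gt_eqF.
rewrite normrM (gtr0_norm sn0); apply: le_trans le_e.
rewrite [leRHS]ger0_norm; last by rewrite mulr_ge0 ?expR_ge0 ?divr_ge0 ?sqr_ge0 ?(ltW sn0).
apply: (@le_trans _ _ (s n * (expR 1 * (`|x| / s n) ^+ 2))).
  by rewrite ler_wpM2l// ltW.
rewrite expr_div_n (real_normK (num_real x)).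
rewrite (_ : s n * _ = expR 1 * (x ^+ 2 / s n))//.
by field; rewrite gt_eqF.
Qed.

(** Here a and b stand for the two counts divided by the mean of the first one,
    and the factor is the ratio of the normalised to the studentized error, up to
    sigma.  It is continuous and equals 1 at (1, exp (- beta)). *)
Lemma studentization_factor (beta eta : R) : 0 < beta -> 0 < eta ->
  exists2 delta, 0 < delta & forall a b : R,
    `|a - 1| < delta -> `|b - expR (- beta)| < delta ->
    [/\ 0 < a, 0 < b, 0 < a / b - 1 &
     `|Num.sqrt (a / b - 1) / (Num.sqrt a * Num.sqrt (expR beta - 1)) - 1| <= eta].
Proof.
move=> beta0 eta0; pose c := expR (- beta).
have c0 : 0 < c by exact: expR_gt0.
have cV : 1 / c = expR beta by rewrite /c expRN div1r invrK.
have s0 : 0 < expR beta - 1 by rewrite subr_gt0 expR_gt1.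
have cfst : (fun z : R * R => z.1) @ ((1, c) : R * R) --> (1 : R) by exact: cvg_fst.
have csnd : (fun z : R * R => z.2) @ ((1, c) : R * R) --> c by exact: cvg_snd.
have cquot : (fun z : R * R => z.1 / z.2 - 1) @ ((1, c) : R * R) --> expR beta - 1.
  rewrite -cV; apply: cvgB; last exact: cvg_cst.
  by apply: cvgM => //; apply: cvgV => //; rewrite gt_eqF.
have csq (f : R * R -> R) l : f @ ((1, c) : R * R) --> l ->
    (fun z => Num.sqrt (f z)) @ ((1, c) : R * R) --> Num.sqrt l.
  by move=> fl; exact: (@cvg_comp _ _ _ f Num.sqrt _ _ _ fl (@sqrt_continuous R l)).
have cK : (fun z : R * R => Num.sqrt (z.1 / z.2 - 1) /
    (Num.sqrt z.1 * Num.sqrt (expR beta - 1))) @ ((1, c) : R * R) --> (1 : R).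
  rewrite [X in _ --> X](_ : _ = Num.sqrt (expR beta - 1) /
      (Num.sqrt 1 * Num.sqrt (expR beta - 1))); last first.
    by rewrite sqrtr1 mul1r divff// gt_eqF// sqrtr_gt0.
  apply: cvgM; first exact: (csq (fun z : R * R => z.1 / z.2 - 1) _ cquot).
  apply: cvgV; first by rewrite sqrtr1 mul1r gt_eqF// sqrtr_gt0.
  apply: cvgM; last exact: cvg_cst.
  exact: (csq (fun z : R * R => z.1) _ cfst).
have /nbhs_ballP[delta /= delta0 H] : \forall z \near ((1, c) : R * R),
    [/\ 0 < z.1, 0 < z.2, 0 < z.1 / z.2 - 1 & `|1 - Num.sqrt (z.1 / z.2 - 1) /
      (Num.sqrt z.1 * Num.sqrt (expR beta - 1))| <= eta].
  near=> z; split; near: z.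
  - exact: (cvgr_gt 1 cfst).
  - exact: (cvgr_gt c csnd).
  - exact: (cvgr_gt _ cquot).
  - by move/cvgrPdist_le : cK; exact.
exists delta => // a b a1 bc.
have [] := H (a, b); first by split; rewrite /ball/= distrC.
by move=> ? ? ? ?; split => //; rewrite distrC.
Unshelve. all: by end_near. Qed.

End exp_limits.

(** * Limit laws under abstract conditions on the thresholds *)

Section nested_thresholds.
Context d (T : measurableType d) (R : realType) (P : probability T R).
Context (S : {RV P >-> nat}) (S_ : nat -> {RV P >-> nat}).
Variables (beta : R) (k : nat -> R).
Let p n := tail_prob S (k n).
Let q n := tail_prob S (k n + 1).
Let N n : R := n%:R * p n.
Let r n := expR beta * (q n / p n).
Let sigma := Num.sqrt (expR beta - 1).
Hypothesis iidS : iid_copies S_ S.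
Hypothesis beta0 : 0 < beta.
Hypothesis Noo : N n @[n --> \oo] --> +oo.
Hypothesis bias : Num.sqrt (N n) * (1 - r n) @[n --> \oo] --> (0 : R).

Let sigma_sqr : sigma ^+ 2 = expR beta - 1.
Proof. by rewrite sqr_sqrtr// subr_ge0 -expR0 ler_expR ltW. Qed.

Let sigma_gt0 : 0 < sigma.
Proof. by rewrite sqrtr_gt0 subr_gt0 expR_gt1. Qed.

Let N_gt0 : \forall n \near \oo, 0 < N n.
Proof. by move/cvgryPgt : Noo; exact. Qed.

Let p_gt0 : \forall n \near \oo, 0 < p n.
Proof.
apply: filterS N_gt0 => n; rewrite lt_neqAle => /andP[N0 _].
rewrite lt_neqAle tail_prob_ge0 andbT.
by apply: contra_neq N0 => p0; rewrite /N -p0 mulr0.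
Qed.

Let n_gt0 : \forall n \near \oo, 0 < n%:R :> R.
Proof. by exists 1%N => // n /=; rewrite ltr0n. Qed.

Let qp n : q n <= p n.
Proof. by apply: le_tail_prob; rewrite lerDl. Qed.

Let kS n : k n <= k n + 1. Proof. by rewrite lerDl. Qed.

Let sN0 : (Num.sqrt (N n))^-1 @[n --> \oo] --> (0 : R).
Proof. exact: cvg_inv_sqrtr0. Qed.

Let r_cvg1 : r n @[n --> \oo] --> (1 : R).
Proof.
have : 1 - Num.sqrt (N n) * (1 - r n) * (Num.sqrt (N n))^-1 @[n --> \oo] -->
    (1 - 0 * 0 : R).
  by apply: cvgB; [exact: cvg_cst|exact: cvgM].
rewrite mulr0 subr0; apply: cvg_trans; apply: near_eq_cvg.
apply: filterS N_gt0 => n Nn0.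
by rewrite mulrAC divff ?mul1r ?subKr// gt_eqF// sqrtr_gt0.
Qed.

Let ratio_cvg : q n / p n @[n --> \oo] --> expR (- beta).
Proof.
have : expR (- beta) * r n @[n --> \oo] --> expR (- beta) * 1.
  by apply: cvgM => //; exact: cvg_cst.
rewrite mulr1; apply: cvg_trans; apply: near_eq_cvg; apply: nearW => n.
by rewrite /r mulrA -expRD addNr expR0 mul1r.
Qed.

Section count_clt.
Variable x : R.
Let E n := expR (x / Num.sqrt (N n)).
Let c n := expR (beta + x / Num.sqrt (N n)).
Let t n := Num.sqrt (N n) * (r n * E n - 1).

Let E1 : E n @[n --> \oo] --> (1 : R).
Proof.
have h : x / Num.sqrt (N n) @[n --> \oo] --> (0 : R).
  by rewrite -[X in _ --> X](mulr0 x); apply: cvgM => //; exact: cvg_cst.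
rewrite -[X in _ --> X]expR0.
exact: (@cvg_comp _ _ _ (fun n => x / Num.sqrt (N n)) expR _ _ _ h
  (@continuous_expR R 0)).
Qed.

Let cE n : c n = expR beta * E n. Proof. exact: expRD. Qed.

Let t_cvg : t n @[n --> \oo] --> x.
Proof.
have h := cvg_expR_increment (x := x) (cvg_sqrtr_pinfty Noo).
have : r n * (Num.sqrt (N n) * (expR (x / Num.sqrt (N n)) - 1)) -
    Num.sqrt (N n) * (1 - r n) @[n --> \oo] --> 1 * x - 0.
  by apply: cvgB => //; exact: cvgM.
rewrite mul1r subr0; apply: cvg_trans; apply: near_eq_cvg; apply: nearW => n.
by rewrite /t /E; ring.
Qed.

Let mean n := 1 * p n + (- c n) * q n.

Let tE n : 0 < N n -> t n = - (n%:R * mean n / Num.sqrt (N n)).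
Proof.
move=> N0.
have p0 : p n != 0 by apply: contraTneq N0 => p0; rewrite /N p0 mulr0 ltxx.
have s0 : Num.sqrt (N n) != 0 by rewrite gt_eqF// sqrtr_gt0.
apply: (mulIf s0); rewrite mulNr divfK// /t mulrAC -expr2 sqr_sqrtr ?ltW//.
by rewrite /mean cE /r /N; field.
Qed.

(** The centred steps are (1_A - c 1_B - mean) / sqrt N, so the event that
    A - c B is nonpositive becomes the event that the walk stays below
    t = sqrt N (r exp (x / sqrt N) - 1), which tends to x. *)
Lemma count_clt : fine (P [set w | n%:R * (1 * emp_tail_prob S_ n (k n) w +
    - c n * emp_tail_prob S_ n (k n + 1) w) <= 0]) @[n --> \oo] -->
  gauss_cdf (x / sigma).
Proof.
pose pr n (a : bool * bool) : R := fine (P (S @^-1` (tail_color (k n) (k n + 1) @^-1` [set a]))).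
pose y n a := (Num.sqrt (N n))^-1 * centered_color S (k n) (k n + 1) 1 (- c n) a.
pose b n := (1 + c n) * 2 * (Num.sqrt (N n))^-1.
have b0 : b n @[n --> \oo] --> (0 : R).
  rewrite (_ : 0 = (1 + expR beta * 1) * 2 * 0); last by ring.
  apply: cvgM => //; apply: cvgM; last exact: cvg_cst.
  apply: cvgD; first exact: cvg_cst.
  rewrite (_ : c = fun n => expR beta * E n); last by apply/funext => n; exact: cE.
  by apply: cvgM => //; exact: cvg_cst.
have step : \forall n \near \oo, [/\ forall a, 0 <= pr n a, \sum_a pr n a = 1,
    \sum_a pr n a * y n a = 0 & forall a, `|y n a| <= b n].
  apply: filterS N_gt0 => n N0; split.
  - exact: tail_color_prob_ge0.
  - exact: tail_color_prob_sum1.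
  - rewrite /y; under eq_bigr do rewrite mulrCA.
    by rewrite -mulr_sumr centered_color_mean// mulr0.
  - move=> a; rewrite /y /b normrM gtr0_norm ?invr_gt0 ?sqrtr_gt0// mulrC.
    rewrite ler_wpM2r ?invr_ge0 ?sqrtr_ge0// /centered_color -/(p n) -/(q n).
    have c0 : 0 <= c n by exact: expR_ge0.
    have p1 : p n <= 1 by exact: tail_prob_le1.
    have q0 : 0 <= q n by exact: tail_prob_ge0.
    have cq : c n * q n <= c n by rewrite ler_piMr// (le_trans (qp n)).
    have cq0 : 0 <= c n * q n by rewrite mulr_ge0.
    have p0 : 0 <= p n by exact: tail_prob_ge0.
    by case: a => -[] []/=; rewrite ler_norml; apply/andP; split; lra.
(* n mean^2 / N is t^2 / n, which vanishes; the rest is 1 - 2 c q/p + c^2 q/p. *)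
have var : n%:R * \sum_a pr n a * y n a ^+ 2 @[n --> \oo] --> sigma ^+ 2.
  rewrite sigma_sqr.
  have : 1 - 2 * (r n * E n) + expR beta * E n * (r n * E n) - t n ^+ 2 * n%:R^-1
      @[n --> \oo] --> 1 - 2 * (1 * 1) + expR beta * 1 * (1 * 1) - x ^+ 2 * 0.
    apply: cvgB; last first.
      apply: cvgM; last by apply/gtr0_cvgV0 => //; exact: cvgr_idn.
      by apply: (@cvg_comp _ _ _ t (fun y : R => y ^+ 2) _ _ _ t_cvg); exact: exprn_continuous.
    apply: cvgD.
      apply: cvgB; first exact: cvg_cst.
      by apply: cvgM; [exact: cvg_cst|exact: cvgM].
    apply: cvgM; last exact: cvgM.
    by apply: cvgM => //; exact: cvg_cst.
  rewrite (_ : _ - x ^+ 2 * 0 = expR beta - 1); last by ring.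
  apply: cvg_trans; apply: near_eq_cvg.
  apply: filterS3 N_gt0 n_gt0 p_gt0 => n N0 n0 p0.
  rewrite /y; under eq_bigr do rewrite exprMn mulrCA.
  rewrite -mulr_sumr centered_color_sqr// -/(p n) -/(q n) -/(mean n).
  rewrite tE// sqrrN exprMn exprVn sqr_sqrtr ?ltW// /r cE /N /mean cE.
  by field; rewrite !gt_eqF.
apply: cvg_trans (walk_clt sigma_gt0 step b0 var t_cvg); apply: near_eq_cvg.
apply: filterS N_gt0 => n N0.
have s0 : 0 < Num.sqrt (N n) by rewrite sqrtr_gt0.
apply/esym; rewrite [X in P X](_ : _ =
    [set w | \sum_(i < n) y n (tail_color (k n) (k n + 1) (S_ i w)) <= t n]).
  exact: (congr1 fine (tail_color_prob iidS (k n) (k n + 1) n (fun s => s <= t n) (y n))).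
apply/seteqP; split=> w /=; rewrite /y -mulr_sumr centered_color_sum -/(mean n);
  rewrite tE//; set X := n%:R * (_ + _ * emp_tail_prob _ _ _ _);
  by rewrite [_^-1 * _]mulrC mulrBl gerDr (@pmulr_lle0 _ _ X) ?invr_gt0.
Qed.

End count_clt.
Let emp n (l : R) w := emp_tail_prob S_ n l w.

Let memp n l : measurable_fun [set: T] (emp n l).
Proof. exact: measurable_emp_tail_prob. Qed.

(** The two counts are close to their limits, after division by N; on this event
    for small delta the estimator is given by its logarithmic formula. *)
Let good (delta : R) n :=
  [set w | `|n%:R * emp n (k n) w / N n - 1| < delta] `&`
  [set w | `|n%:R * emp n (k n + 1) w / N n - expR (- beta)| < delta].

Let measurable_good delta n : measurable (good delta n).
Proof.
by apply: measurableI; apply: measurable_level_dist;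
  apply: measurable_funM => //; apply: measurable_funM => //; exact: memp.
Qed.

Let good_cvg (delta : R) : 0 < delta ->
  fine (P (~` good delta n)) @[n --> \oo] --> (0 : R).
Proof.
move=> d0; have d20 : 0 < delta / 2 by rewrite divr_gt0.
have /cvgrPdist_lt/(_ _ d20) rd := ratio_cvg.
have ub : 5 * delta ^- 2 * (N n)^-1 @[n --> \oo] --> (0 : R).
  rewrite -[X in _ --> X](mulr0 (5 * delta ^- 2)).
  by apply: cvgM; [exact: cvg_cst|exact/gtr0_cvgV0].
apply: squeeze_cvgr (cvg_cst _) ub.
apply: filterS3 rd N_gt0 p_gt0 => n rd N0 p0.
rewrite fine_ge0//=.
have n0 : 0 < n%:R :> R by move: N0; rewrite /N pmulr_lgt0.
pose U := [set w | `|n%:R * emp n (k n) w - N n| < delta * N n].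
pose V := [set w | `|n%:R * emp n (k n + 1) w - n%:R * q n| < delta / 2 * N n].
have mU : measurable U by apply: measurable_level_dist; exact: measurable_funM.
have mV : measurable V by apply: measurable_level_dist; exact: measurable_funM.
have dN0 : 0 < delta * N n by rewrite mulr_gt0.
have d2N0 : 0 < delta / 2 * N n by rewrite mulr_gt0.
have PU : fine (P (~` U)) <= N n / (delta * N n) ^+ 2.
  rewrite (_ : ~` U = [set w | delta * N n <= `|n%:R * emp n (k n) w - N n|]).
    exact: emp_tail_prob_deviation.
  by apply/seteqP; split=> w /=; rewrite leNgt => /negP.
have PV : fine (P (~` V)) <= n%:R * q n / (delta / 2 * N n) ^+ 2.
  rewrite (_ : ~` V = [set w | delta / 2 * N n <=
      `|n%:R * emp n (k n + 1) w - n%:R * q n|]).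
    exact: emp_tail_prob_deviation.
  by apply/seteqP; split=> w /=; rewrite leNgt => /negP.
have UV : U `&` V `<=` good delta n.
  move=> w [Uw Vw]; split=> /=.
    rewrite -[X in _ - X](divff (lt0r_neq0 N0)) -mulrBl normrM normfV.
    by rewrite (gtr0_norm N0) ltr_pdivrMr.
  rewrite (_ : _ - _ = (n%:R * emp n (k n + 1) w - n%:R * q n) / N n +
      (q n / p n - expR (- beta))); last first.
    by rewrite /N; field; rewrite !gt_eqF.
  apply: le_lt_trans (ler_normD _ _) _; rewrite [ltRHS]splitr ltrD//.
    by rewrite normrM normfV (gtr0_norm N0) ltr_pdivrMr.
  by rewrite distrC.
apply: (@le_trans _ _ (fine (P (~` U)) + fine (P (~` V)))).
  rewrite -lee_fin EFinD !fine_measureK; try exact: measurableC.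
  apply: (@le_trans _ _ (P (~` U `|` ~` V))).
    apply: le_measure; rewrite ?inE; try exact: measurableC.
      by apply: measurableU; exact: measurableC.
    by rewrite -setCI; exact: subsetC.
  by apply: measureU2; exact: measurableC.
apply: le_trans (lerD PU PV) _.
apply: (@le_trans _ _ (N n / (delta * N n) ^+ 2 + N n / (delta / 2 * N n) ^+ 2)).
  rewrite lerD2l ler_wpM2r ?invr_ge0 ?exprn_ge0 ?(ltW d2N0)//.
  by rewrite ler_wpM2l// ltW.
rewrite le_eqVlt; apply/orP; left; apply/eqP; field.
by rewrite !gt_eqF.
Qed.

(** On the good event, taking exponentials turns the inequality between the
    normalised error and x into a linear inequality between the two counts, to
    which [count_clt] applies. *)
Lemma normalized_error_clt x :
  fine (P [set w | normalized_error S S_ beta n (k n) w <= x]) @[n --> \oo] -->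
  gauss_cdf (x / sigma).
Proof.
(* This delta is below 1/2 and below exp (- beta), so both counts are positive. *)
have b1 : expR (- beta) < 1 by rewrite expR_lt1 oppr_lt0.
pose delta := expR (- beta) / 2.
have d0 : 0 < delta by rewrite divr_gt0 ?expR_gt0.
have cl := count_clt (x := x).
have lo : (fun n => fine (P [set w | n%:R * (1 * emp_tail_prob S_ n (k n) w +
    - expR (beta + x / Num.sqrt (N n)) * emp_tail_prob S_ n (k n + 1) w) <= 0]) -
    fine (P (~` good delta n))) @ \oo --> gauss_cdf (x / sigma) - 0.
  by apply: cvgB => //; exact: good_cvg.
have up : (fun n => fine (P [set w | n%:R * (1 * emp_tail_prob S_ n (k n) w +
    - expR (beta + x / Num.sqrt (N n)) * emp_tail_prob S_ n (k n + 1) w) <= 0]) +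
    fine (P (~` good delta n))) @ \oo --> gauss_cdf (x / sigma) + 0.
  by apply: cvgD => //; exact: good_cvg.
rewrite subr0 in lo; rewrite addr0 in up.
apply: squeeze_cvgr lo up.
apply: filterS2 N_gt0 n_gt0 => n N0 n0.
set E := [set w | normalized_error _ _ _ _ _ w <= x].
set F := [set w | _ <= 0].
have mE : measurable E by apply: measurable_level_le; exact: measurable_normalized_error.
have mF : measurable F.
  apply: measurable_level_le; apply: measurable_funM => //.
  by apply: measurable_funD; apply: measurable_funM.
have EF w : good delta n w -> E w <-> F w.
  move=> [/= ga gb].
  have e1 : 0 < emp n (k n) w.
    move: ga; rewrite ltr_norml => /andP[ga _].
    have : 0 < n%:R * emp n (k n) w / N n by rewrite /delta in ga; lra.
    by rewrite pmulr_lgt0 ?invr_gt0// pmulr_rgt0.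
  have e2 : 0 < emp n (k n + 1) w.
    move: gb; rewrite ltr_norml => /andP[gb _].
    have : 0 < n%:R * emp n (k n + 1) w / N n.
      by have := expR_gt0 (- beta); rewrite /delta in gb; lra.
    by rewrite pmulr_lgt0 ?invr_gt0// pmulr_rgt0.
  have s0 : 0 < Num.sqrt (N n) by rewrite sqrtr_gt0.
  rewrite /E /F /= /normalized_error /tail_index_est -/(emp _ _ _) -/(emp _ _ _) e2.
  rewrite -/(p n) -/(N n) pmulr_rle0// mul1r mulNr subr_le0.
  rewrite mulrC -ler_pdivlMr//; set y := x / _.
  move: (emp n (k n) w) (emp n (k n + 1) w) e1 e2 => u1 u2 u10 u20.
  rewrite -[X in _ <-> is_true X]ler_ln ?posrE ?mulr_gt0 ?expR_gt0//.
  by rewrite lnM ?posrE ?expR_gt0// expRK; split=> h; lra.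
apply/andP; split.
  rewrite lerBlDr; apply: fine_prob_le_off => // w [Fw Gw].
  exact/(EF _ Gw).
by apply: fine_prob_le_off => // w [Ew Gw]; exact/(EF _ Gw).
Qed.

Lemma studentized_error_clt a x :
  fine (P [set w | studentized_error S_ beta a n (k n) w <= x]) @[n --> \oo] -->
  gauss_cdf x.
Proof.
move: x; apply: (@slutsky_ratio _ _ _ _ _
  (fun n w => normalized_error S S_ beta n (k n) w / sigma)).
- by move=> n; exact: measurable_studentized_error.
- by move=> n; apply: measurable_funM => //; exact: measurable_normalized_error.
- exact: continuous_gauss_cdf.
- move=> x; have := normalized_error_clt (x := x * sigma).
  rewrite mulfK ?gt_eqF//; apply: cvg_trans; apply: near_eq_cvg; apply: nearW => n.
  congr (fine (P _)); apply/seteqP; split=> w /=; by rewrite ler_pdivrMr.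
move=> eta eta0 _.
have [delta delta0 H] := studentization_factor beta0 eta0.
exists (good delta); split; [exact: measurable_good|exact: good_cvg|].
apply: filterS2 N_gt0 n_gt0 => n N0 n0 w [/= ga gb].
have [a0 b0 ab0] := H _ _ ga gb.
set A := n%:R * emp n (k n) w / N n in a0 ab0 *.
set B := n%:R * emp n (k n + 1) w / N n in b0 ab0 *.
set K := (X in `|X - 1|) => HK; exists K => //.
have e1 : 0 < emp n (k n) w by move: a0; rewrite pmulr_lgt0 ?invr_gt0// pmulr_rgt0.
have e2 : 0 < emp n (k n + 1) w by move: b0; rewrite pmulr_lgt0 ?invr_gt0// pmulr_rgt0.
have est : tail_index_est S_ n (k n) w = ln (emp n (k n) w) - ln (emp n (k n + 1) w).
  by rewrite /tail_index_est -/(emp _ _ _) -/(emp _ _ _) e2.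
have Eest : expR (tail_index_est S_ n (k n) w) = A / B.
  rewrite est expRD expRN !lnK ?posrE// /A /B.
  by field; rewrite !gt_eqF.
have nA : n%:R * emp n (k n) w = N n * A by rewrite /A; field; rewrite gt_eqF.
have sA : 0 < Num.sqrt A by rewrite sqrtr_gt0.
have sAB : 0 < Num.sqrt (A / B - 1) by rewrite sqrtr_gt0.
rewrite /studentized_error Eest /= (gt_eqF sAB) -/(emp _ _ _) nA sqrtrM ?(ltW N0)//.
rewrite /normalized_error -/(p n) -/(N n) /K -/sigma.
by field; rewrite !gt_eqF.
Qed.

End nested_thresholds.

(** * Regularly varying tails *)

Section regular_variation.
Context d (T : measurableType d) (R : realType) (P : probability T R).
Variables (S : {RV P >-> nat}) (beta : R) (L : R -> R) (k : nat -> R).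
Hypothesis Spareto : discrete_gen_pareto S beta L.
Hypothesis koo : k n @[n --> \oo] --> +oo%R.
Let p n := tail_prob S (k n).
Let q n := tail_prob S (k n + 1).

Lemma tail_prob_pareto l : 0 <= l ->
  tail_prob S l = expR (- (l * beta)) * L (expR l).
Proof.
move=> l0; have [_ _ _ tail] := Spareto.
apply: EFin_inj; rewrite tail_probE tail -?expR0 ?ler_expR//.
by rewrite -mulrN expRM.
Qed.

(** Since p_k = exp (- k beta) L (exp k), the hypothesis says that ln n is
    at most epsilon n p_(k_n) for large n, whatever epsilon, while ln n >= ln 2. *)
Lemma expected_exceedances_pinfty :
  (fun n => ln n%:R * expR (k n * beta) / n%:R : R^o) =o_\oo
    (fun n => L (expR (k n)) : R^o) ->
  n%:R * p n @[n --> \oo] --> +oo.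
Proof.
move=> /eqoP Lo; apply/cvgryPge => M.
pose M' := `|M| + 1; have M0 : 0 < M' by rewrite ltr_wpDl.
have l20 : 0 < ln 2 :> R by rewrite ln_gt0// ltr1n.
have e0 : 0 < ln 2 / M' by rewrite divr_gt0.
have k0 : \forall n \near \oo, 0 <= k n by move/cvgryPge : koo; exact.
have n2 : \forall n \near \oo, (2 <= n)%N by exists 2%N.
apply: filterS3 k0 n2 (Lo _ e0) => n kn n2 Ln.
have n0 : 0 < n%:R :> R by rewrite ltr0n (leq_trans _ n2).
have Ek0 := expR_gt0 (k n * beta).
have L0 : 0 <= L (expR (k n)).
  have := tail_prob_ge0 S (k n); rewrite tail_prob_pareto//.
  by rewrite pmulr_rge0 ?expR_gt0.
have ln2n : ln 2 <= ln n%:R :> R by rewrite ler_ln ?posrE// ler_nat.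
have ln0 : 0 <= ln n%:R :> R by rewrite (le_trans _ ln2n)// ltW.
move: Ln; rewrite /= ger0_norm; last first.
  by rewrite !mulr_ge0 ?invr_ge0 ?(ltW n0) ?(ltW Ek0).
rewrite (ger0_norm L0) => Ln.
apply: (@le_trans _ _ M'); first by rewrite (le_trans (ler_norm _))// lerDl.
rewrite /p tail_prob_pareto// expRN mulrCA mulrC ler_pdivlMr//.
rewrite -(ler_pM2l l20) mulrA [_ * M']mulrC -mulrA.
apply: (@le_trans _ _ (M' * (ln n%:R * expR (k n * beta)))).
  by rewrite ler_pM2l// ler_pM2r.
apply: (@le_trans _ _ (M' * (ln 2 / M' * L (expR (k n)) * n%:R))).
  by rewrite ler_pM2l// -ler_pdivrMr.
by rewrite le_eqVlt; apply/orP; left; apply/eqP; field; rewrite gt_eqF.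
Qed.

(** With rho = L (exp (k + 1)) / L (exp k), the ratio of tail probabilities is
    exp (- beta) rho, and 1 - rho = - rho (1 - 1 / rho) where rho tends to 1 by
    slow variation. *)
Lemma tail_prob_ratio_bias (N : nat -> R) : (\forall n \near \oo, 0 < p n) ->
  N n * (1 - L (expR (k n)) / L (expR (k n + 1))) @[n --> \oo] --> (0 : R) ->
  N n * (1 - expR beta * (q n / p n)) @[n --> \oo] --> (0 : R).
Proof.
move=> p0 bias; have [_ slow _ _] := Spareto.
pose rho n := L (expR (k n + 1)) / L (expR (k n)).
have Ekoo : expR (k n) @[n --> \oo] --> +oo.
  apply/cvgryPge => M; move/cvgryPge : koo => /(_ M); apply: filterS => n Mk.
  by rewrite (le_trans Mk)// (le_trans _ (expR_ge1Dx _))// lerDr.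
have rho1 : rho n @[n --> \oo] --> (1 : R).
  have := slow (expR 1) (expR_gt0 1) => slow1.
  have := @cvg_comp _ _ _ (fun n => expR (k n))
    (fun z => L (expR 1 * z) / L z) _ _ _ Ekoo slow1.
  apply: cvg_trans; apply: near_eq_cvg; apply: nearW => n /=.
  by rewrite /rho expRD (mulrC (expR 1)).
have : - rho n * (N n * (1 - L (expR (k n)) / L (expR (k n + 1)))) @[n --> \oo]
    --> - 1 * (0 : R).
  by apply: cvgM => //; exact: cvgN.
rewrite mulr0; apply: cvg_trans; apply: near_eq_cvg.
have k0 : \forall n \near \oo, 0 <= k n by move/cvgryPge : koo; exact.
have rho0 : \forall n \near \oo, 0 < rho n by apply: (cvgr_gt 1 rho1).
apply: filterS3 k0 rho0 p0 => n kn r0.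
rewrite /p /q !tail_prob_pareto//; last by rewrite addr_ge0.
rewrite pmulr_rgt0 ?expR_gt0// => L0.
have L1 : L (expR (k n + 1)) != 0.
  by apply: contraTneq r0 => L1; rewrite /rho L1 mul0r ltxx.
rewrite /rho; move: (L _) (L (expR (k n))) L0 L1 => l1 l0 L0 L1.
rewrite mulrDl mul1r opprD expRD !expRN.
have := expR_gt0 (k n * beta); have := expR_gt0 beta => ? ?.
by field; rewrite L1 !gt_eqF.
Qed.

End regular_variation.

Lemma cvg_in_distribution_normal d (T : measurableType d) (R : realType)
    (P : probability T R) (X : nat -> {RV P >-> R}) (s : R) : 0 < s ->
  (forall x, fine (P [set w | X n w <= x]) @[n --> \oo] --> gauss_cdf (x / s)) ->
  cvg_in_distribution X (normal_prob 0 s).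
Proof.
move=> s0 cX x _; have normE : normal_prob 0 s `]-oo, x]%classic = _ := normal_probE x s0.
rewrite [X in _ --> X]normE.
have -> : (fun n => cdf (X n) x) = EFin \o (fun n => fine (P [set w | X n w <= x])).
  apply/funext => n; rewrite /= fine_measureK; last exact: measurable_level_le.
  rewrite (_ : [set w | X n w <= x] = X n @^-1` `]-oo, x]%classic)//.
by apply: cvg_EFin; [exact: nearW|exact: cX].
Qed.

Theorem corollary2p2 (d : measure_display) (T : measurableType d)
    (R : realType) (P : probability T R)
    (S : {RV P >-> nat}) (S_ : nat -> {RV P >-> nat})
    (beta : R) (L : R -> R) (k : nat -> R) (a : R) :
  discrete_gen_pareto S beta L ->
  iid_copies S_ S ->
  k n @[n --> \oo] --> +oo%R ->
  (fun n => ln n%:R * expR (k n * beta) / n%:R : R^o) =o_\oo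
    (fun n => L (expR (k n)) : R^o) ->
  (Num.sqrt (n%:R * tail_prob S (k n))
     * (1 - L (expR (k n)) / L (expR (k n + 1)))) @[n --> \oo] --> (0 : R) ->
  cvg_in_distribution
    (fun n => normalized_error S S_ beta n (k n) : {RV P >-> R})
    (normal_prob 0 (Num.sqrt (expR beta - 1)))
  /\
  cvg_in_distribution
    (fun n => studentized_error S_ beta a n (k n) : {RV P >-> R})
    (normal_prob 0 1).

Proof.
move=> Spareto iidS koo Lo bias.
have [beta0 _ _ _] := Spareto.
have Noo := expected_exceedances_pinfty Spareto koo Lo.
have p0 : \forall n \near \oo, 0 < tail_prob S (k n).
  move/cvgryPgt : Noo => /(_ 0); apply: filterS => n /gt_eqF/negbT N0.
  rewrite lt_neqAle tail_prob_ge0 andbT.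
  by apply: contraNneq N0 => <-; rewrite mulr0.
have bias' := tail_prob_ratio_bias Spareto koo p0 bias.
split; apply: cvg_in_distribution_normal.
- by rewrite sqrtr_gt0 subr_gt0 expR_gt1.
- by move=> x; exact: normalized_error_clt.
- exact: ltr01.
- move=> x; rewrite divr1. exact: (studentized_error_clt iidS beta0 Noo bias').
Qed.
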